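(* Let $b$ be a nonnegative integer, let $(a_n)_n$ be a sequence of nonnegative real numbers, put $\alpha_n=a_n/n$, and assume $0\le\liminf_n\alpha_n<\infty$. Then for any $u,v\in\mathbb{R}_+$, as $n\to\infty$, $$\frac{1}{2n^2(1+\alpha_n)}K_n^{a_n,b}\!\left(-1+\frac{u}{2n^2(1+\alpha_n)},\,-1+\frac{v}{2n^2(1+\alpha_n)}\right)=F_b(u,v)+O(n^{-1}),$$ and this estimate is uniform for $u,v$ in any compact set in $\mathbb{R}_+$.
   Context: For $a,b\ge0$ let $w^{a,b}(x)=(1-x)^a(1+x)^b$ on $[-1,1]$, let $(p_j^{a,b})_{j\ge0}$ be the orthonormal polynomials for the measure $w^{a,b}(x)\mathbf 1_{[-1,1]}(x)\,dx$ ($\deg p_j^{a,b}=j$), and let $$K_n^{a,b}(x,y)=\sqrt{w^{a,b}(x)}\sqrt{w^{a,b}(y)}\sum_{j=0}^{n-1}p_j^{a,b}(x)p_j^{a,b}(y).$$ The Bessel kernel is $$F_b(u,v)=\frac{J_b(\sqrt u)\sqrt v\,J_b'(\sqrt v)-J_b(\sqrt v)\sqrt u\,J_b'(\sqrt u)}{2(u-v)}$$ (extended by continuity to $u=v$ and to the boundary of $\mathbb{R}_+^2$), where $J_b(z)=(z/2)^b\sum_{m=0}^\infty\frac{(-1)^m}{(m+b)!\,m!}(z/2)^{2m}$ is the Bessel function of the first kind of order $b$. *)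

(* Defs.v *)
From HB Require Import structures.
From mathcomp Require Import all_boot all_order all_algebra.
From mathcomp Require Import all_classical all_reals all_analysis.

Set Implicit Arguments.
Unset Strict Implicit.
Unset Printing Implicit Defensive.

Import Order.TTheory GRing.Theory Num.Theory.
Import numFieldNormedType.Exports.

Local Open Scope classical_set_scope.
Local Open Scope ring_scope.

(* Only used for x in [-1, 1] and a, b >= 0; note that 0 `^ 0 = 1. *)
Definition jacobi_weight (R : realType) (a b x : R) : R :=
  (1 - x) `^ a * (1 + x) `^ b.

(* [size q = j.+1] means that q has degree j. The condition determines each
   p j up to its sign, which plays no role in the kernel below. *)
Definition orthonormal_jacobi (R : realType) (a b : R)
    (p : nat -> {poly R}) : Prop :=
  (forall j, size (p j) = j.+1) /\
  (forall i j,
     (\int[@lebesgue_measure R]_(x in `[(-1), 1])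
        ((p i).[x] * (p j).[x] * jacobi_weight a b x))%R = (i == j)%:R).

Definition jacobi_kernel (R : realType) (a b : R) (p : nat -> {poly R})
    (n : nat) (x y : R) : R :=
  Num.sqrt (jacobi_weight a b x) * Num.sqrt (jacobi_weight a b y) *
  \sum_(j < n) (p j).[x] * (p j).[y].

Definition bessel_J (R : realType) (b : nat) (z : R) : R :=
  (z / 2) ^+ b *
  limn (series (fun m : nat =>
    (-1) ^+ m / (((m + b)`!)%:R * (m`!)%:R) * (z / 2) ^+ (2 * m))).

Definition bessel_kernel_off_diag (R : realType) (b : nat) (u v : R) : R :=
  (bessel_J b (Num.sqrt u) * Num.sqrt v * derive1 (@bessel_J R b) (Num.sqrt v)
   - bessel_J b (Num.sqrt v) * Num.sqrt u * derive1 (@bessel_J R b) (Num.sqrt u))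
  / (2 * (u - v)).

Definition off_diag_quadrant (R : realType) : set (R * R) :=
  [set q : R * R | [/\ 0 < q.1, 0 < q.2 & q.1 != q.2]].

(* On the diagonal and on the boundary of the quadrant u, v >= 0, the value is
   the two-variable limit of the formula taken from off_diag_quadrant. *)
Definition bessel_kernel (R : realType) (b : nat) (u v : R) : R :=
  if [&& 0 < u, 0 < v & u != v] then bessel_kernel_off_diag b u v
  else lim ((fun q : R * R => bessel_kernel_off_diag b q.1 q.2) @
              within (@off_diag_quadrant R) (nbhs (u, v))).

Definition rescaled_jacobi_kernel (R : realType) (a b : R)
    (p : nat -> {poly R}) (n : nat) (u v : R) : R :=
  let s := 2 * n%:R ^+ 2 * (1 + a / n%:R) in
  s^-1 * jacobi_kernel a b p n (-1 + u / s) (-1 + v / s).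

(* Main.v *)
(** Write [t = (1 + x) / 2] and [N = n (n + a)], so that the scaling is
    [t = (u / 4) / N]. Orthonormality determines the products
    [p_j(x) p_j(y)]; they are expressed through the hypergeometric Jacobi
    polynomials, whose orthogonality follows from the symmetry of the Jacobi
    differential operator and whose norm follows by induction on the degree,
    since the derivative is a Jacobi polynomial with parameters [a + 1, b + 1].
    Put [q_j = j (j + a) / N]. The [m]-th coefficient of the [j]-th
    polynomial, rescaled by [N ^ m], is within [O(1/n)] of [q_j ^ m] times the
    [m]-th coefficient of the Bessel series [phi_b], where
    [J_b(z) = (z/2)^b phi_b((z/2)^2)]. Hence, up to a factor tending to 1, the
    rescaled kernel is
    [(xy)^(b/2) / 4] times a Riemann sum over the grid [q_0 = 0, ..., q_n = 1],
    of mesh at most [2/n] uniformly in [a], for the integral of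
    [q^b phi_b(qx) phi_b(qy)], with [x = u/4] and [y = v/4]. For [x != y] the
    Bessel equation yields an explicit primitive of this integrand, and its
    value at [q = 1] gives [F_b(u, v)]. The estimate is uniform off the
    diagonal; since the rescaled kernels are continuous, this makes the
    off-diagonal formula Cauchy at every other point of the closed quadrant, so
    the defining limit exists there and satisfies the same estimate. *)
Require Import Defs.
From HB Require Import structures.
From mathcomp Require Import all_boot all_order all_algebra.
From mathcomp Require Import all_classical all_reals all_analysis.
From mathcomp Require Import ring lra.

Set Implicit Arguments.
Unset Strict Implicit.
Unset Printing Implicit Defensive.

Import Order.TTheory GRing.Theory Num.Theory.
Import numFieldNormedType.Exports.

Local Open Scope classical_set_scope.
Local Open Scope ring_scope.

(** * The Jacobi differential operator on polynomials *)

(** This is the integral of [y ^ c * q(y)] over [[0, 1]], encoded by its values [1 / (c + k + 1)] on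
    monomials, so that integration by parts becomes polynomial algebra. *)
Definition moment (R : realType) (c : R) (q : {poly R}) : R :=
  \sum_(k < size q) q`_k / (c + k.+1%:R).

Lemma moment_widen (R : realType) (c : R) (q : {poly R}) n :
  (size q <= n)%N -> moment c q = \sum_(k < n) q`_k / (c + k.+1%:R).
Proof.
move=> qn; rewrite /moment (big_ord_widen _ (fun k => q`_k / (c + k.+1%:R)) qn).
rewrite big_mkcond; apply: eq_bigr => k _; case: ltnP => // ?.
by rewrite nth_default// mul0r.
Qed.

Lemma moment_is_linear (R : realType) (c : R) : linear_for *%R (@moment R c).
Proof.
move=> l p q; pose n := maxn (size (l *: p + q)) (maxn (size p) (size q)).
rewrite (@moment_widen _ _ (l *: p + q) n) ?leq_max ?leqnn//.
rewrite (@moment_widen _ _ p n) ?leq_max ?leqnn ?orbT//.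
rewrite (@moment_widen _ _ q n) ?leq_max ?leqnn ?orbT//.
rewrite mulr_sumr -big_split/=; apply: eq_bigr => k _.
by rewrite coefD coefZ mulrDl mulrA.
Qed.

HB.instance Definition _ (R : realType) (c : R) :=
  GRing.isLinear.Build R {poly R} R *%R (@moment R c) (@moment_is_linear R c).

(** The integrand [y ^ c * (y * S' + (c + 1) * S)] is the derivative of [y ^ (c + 1) * S], which
    vanishes at 0. *)
Lemma moment_deriv (R : realType) (c : R) (S : {poly R}) : 0 <= c ->
  moment c ('X * S^`() + (c + 1)%:P * S) = S.[1].
Proof.
move=> c0; set T := _ + _; pose n := maxn (size T) (size S).
rewrite (@moment_widen _ _ _ n) ?leq_max ?leqnn//.
rewrite (@horner_coef_wide _ n) ?leq_max ?leqnn ?orbT//.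
apply: eq_bigr => k _; rewrite expr1n mulr1 /T coefD coefXM coefCM coef_deriv.
have ck : c + k.+1%:R != 0 by rewrite gt_eqF// ltr_wpDl.
case: ifPn => [/eqP k0|k0].
  by rewrite k0 add0r mulrC mulKf// -k0.
rewrite prednK ?lt0n// -(mulr_natl S`_k) -mulrDl mulrC.
have -> : k%:R + (c + 1) = c + k.+1%:R by rewrite -addn1 natrD; ring.
by rewrite mulKf.
Qed.

Lemma moment_mulX (R : realType) (c : R) (q : {poly R}) :
  moment c ('X * q) = moment (c + 1) q.
Proof.
rewrite (@moment_widen _ _ ('X * q) (size q).+1); last first.
  by rewrite (leq_trans (size_polyMleq _ _))// size_polyX.
rewrite big_ord_recl coefXM/= mul0r add0r; apply: eq_bigr => k _.
by rewrite coefXM/= -addrA nat1r.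
Qed.

(* [moment a] integrates against [y ^ a] on [0, 1]; [jint a] integrates
   against [(1 - t) ^ a], through [y = 1 - t]. *)
Definition jint (R : realType) (a : R) (q : {poly R}) : R :=
  moment a (q \Po (1 - 'X)).

Lemma jint_is_linear (R : realType) (a : R) : linear_for *%R (@jint R a).
Proof. by move=> l p q; rewrite /jint linearP/= linearP. Qed.

HB.instance Definition _ (R : realType) (a : R) :=
  GRing.isLinear.Build R {poly R} R *%R (@jint R a) (@jint_is_linear R a).

Lemma jint_deriv (R : realType) (a : R) (S : {poly R}) : 0 <= a ->
  jint a ((1 - 'X) * S^`() - (a + 1)%:P * S) = - S.[0].
Proof.
move=> a0; have := @moment_deriv R a (S \Po (1 - 'X)) a0.
rewrite horner_comp !hornerE subrr => <-; rewrite -linearN/= /jint.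
congr (moment a _).
rewrite rmorphB/= !rmorphM/= rmorphB/= comp_polyX rmorph1/=.
rewrite deriv_comp derivB derivX -polyC1 derivC !comp_polyC; ring.
Qed.

Lemma jint_mul1X (R : realType) (a : R) (q : {poly R}) :
  jint a ((1 - 'X) * q) = jint (a + 1) q.
Proof.
rewrite /jint -moment_mulX; congr moment.
by rewrite rmorphM/= rmorphB/= comp_polyX rmorph1; congr (_ * _); ring.
Qed.

(** With [w = t ^ b * (1 - t) ^ a] this is [(t * (1 - t) * w * q')' / w], the Jacobi operator moved
    from [[-1, 1]] to [[0, 1]]. *)
Definition jacobi_op (R : realType) (a : R) (b : nat) (q : {poly R}) :
    {poly R} :=
  'X * (1 - 'X) * q^`()^`()
  + (b.+1%:R%:P - (a + b.+2%:R)%:P * 'X) * q^`().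

(** Integration by parts: [jint_deriv] for [S = t ^ (b + 1) * q' * r], whose value at 0 is zero. The
    right-hand side is symmetric in [q] and [r]. *)
Lemma jacobi_op_sym (R : realType) (a : R) (b : nat) (q r : {poly R}) :
  0 <= a ->
  jint a ('X^b * jacobi_op a b q * r)
  = - jint (a + 1) ('X^(b.+1) * q^`() * r^`()).
Proof.
move=> a0; apply/eqP; rewrite -subr_eq0 opprK -jint_mul1X -linearD/=.
have := @jint_deriv R a ('X^(b.+1) * q^`() * r) a0.
rewrite !hornerM hornerXn expr0n/= !mul0r oppr0 => <-; apply/eqP.
congr jint; rewrite /jacobi_op !derivM.
have -> : ('X^(b.+1) : {poly R})^`() = b.+1%:R%:P * 'X^b.
  by rewrite derivXn polyC_natr mulr_natl.
rewrite exprS -!natr1 !polyCD.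
move: 'X^b => Xb; ring.
Qed.

(** * Hypergeometric Jacobi polynomials: eigenvalue equation, orthogonality, norms *)

Definition jacobi_eigen (R : realType) (a : R) (b j : nat) : R :=
  j%:R * (j%:R + a + b%:R + 1).

(* Equal to [\prod_(i < m) (jacobi_eigen a b j - jacobi_eigen a b i)]. *)
Definition jacobi_fact (R : realType) (a : R) (b j m : nat) : R :=
  \prod_(i < m) ((j%:R - i%:R) * (j%:R + i%:R + a + b%:R + 1)).

Definition bessel_coef (R : realType) (b m : nat) : R :=
  (-1) ^+ m / ((m + b)`!%:R * m`!%:R).

(* A multiple of the Jacobi polynomial, as a polynomial in [t = (1 + x) / 2]. *)
Definition jacobi_poly (R : realType) (a : R) (b j : nat) : {poly R} :=
  \poly_(m < j.+1) (bessel_coef R b m * jacobi_fact a b j m).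

Lemma jacobi_factS (R : realType) (a : R) (b j m : nat) :
  jacobi_fact a b j m.+1 =
  jacobi_fact a b j m * ((j%:R - m%:R) * (j%:R + m%:R + a + b%:R + 1)).
Proof. by rewrite /jacobi_fact big_ord_recr. Qed.

Lemma jacobi_fact_eq0 (R : realType) (a : R) (b j m : nat) : (j < m)%N ->
  jacobi_fact a b j m = 0.
Proof.
move=> jm; apply/eqP/prodf_eq0; exists (Ordinal jm) => //=.
by rewrite subrr mul0r.
Qed.

Lemma jacobi_fact_gt0 (R : realType) (a : R) (b j m : nat) : 0 <= a ->
  (m <= j)%N -> 0 < jacobi_fact a b j m.
Proof.
move=> a0 mj; apply: prodr_gt0 => i _; apply: mulr_gt0.
  by rewrite subr_gt0 ltr_nat (leq_trans _ mj).
by rewrite ltr_wpDl// !addr_ge0.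
Qed.

Lemma coef_jacobi_poly (R : realType) (a : R) (b j m : nat) :
  (jacobi_poly a b j)`_m = bessel_coef R b m * jacobi_fact a b j m.
Proof.
by rewrite coef_poly; case: ltnP => // jm; rewrite jacobi_fact_eq0 ?mulr0.
Qed.

Lemma bessel_coef_neq0 (R : realType) (b m : nat) : bessel_coef R b m != 0.
Proof.
by rewrite mulf_neq0 ?signr_eq0// invr_neq0// mulf_neq0// pnatr_eq0 -lt0n fact_gt0.
Qed.

(** Coefficient form of [phi_b' = - phi_(b+1)]. *)
Lemma bessel_coefS (R : realType) (b m : nat) :
  m.+1%:R * bessel_coef R b m.+1 = - bessel_coef R b.+1 m.
Proof.
have m0 : m`!%:R != 0 :> R by rewrite pnatr_eq0 -lt0n fact_gt0.
have mb0 : (m + b.+1)`!%:R != 0 :> R by rewrite pnatr_eq0 -lt0n fact_gt0.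
rewrite /bessel_coef exprS addSnnS [in LHS]factS natrM; field.
by rewrite m0 mb0 -(natrD _ 1) pnatr_eq0.
Qed.

(** Coefficient form of [(t ^ (b + 1) * phi_(b+1))' = t ^ b * phi_b]. *)
Lemma bessel_coefS2 (R : realType) (b m : nat) :
  (m + b).+1%:R * bessel_coef R b.+1 m = bessel_coef R b m.
Proof.
have m0 : m`!%:R != 0 :> R by rewrite pnatr_eq0 -lt0n fact_gt0.
have mb0 : (m + b)`!%:R != 0 :> R by rewrite pnatr_eq0 -lt0n fact_gt0.
rewrite /bessel_coef addnS factS natrM -[(m + b).+1%:R]natr1 natrD; field.
by rewrite m0 mb0 /= -natrD natr1 pnatr_eq0.
Qed.

Lemma size_jacobi_poly (R : realType) (a : R) (b j : nat) : 0 <= a ->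
  size (jacobi_poly a b j) = j.+1.
Proof.
move=> a0; apply: size_poly_eq; rewrite mulf_neq0 ?bessel_coef_neq0//.
by rewrite gt_eqF// jacobi_fact_gt0.
Qed.

Lemma coef_jacobi_op (R : realType) (a : R) (b m : nat) (q : {poly R}) :
  (jacobi_op a b q)`_m = m.+1%:R * (m + b).+1%:R * q`_m.+1
    - m%:R * (m%:R + a + b%:R + 1) * q`_m.
Proof.
rewrite /jacobi_op mulrBr mulr1 !mulrBl -!mulrA.
rewrite coefD !coefB !coefXM !coefCM coefXM !coef_deriv.
by case: m => [|[|m]] /=; rewrite ?natrD; ring.
Qed.

(** The equation is a two-term recurrence for the coefficients. It holds because the factor gained
    in [jacobi_factS] is the difference of the eigenvalues of degrees [j] and [m]. *)
Lemma jacobi_poly_eigen (R : realType) (a : R) (b j : nat) :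
  jacobi_op a b (jacobi_poly a b j)
  = - jacobi_eigen a b j *: jacobi_poly a b j.
Proof.
apply/polyP => m; rewrite coef_jacobi_op coefZ !coef_jacobi_poly jacobi_factS.
have -> : m.+1%:R * (m + b).+1%:R * (bessel_coef R b m.+1 *
    (jacobi_fact a b j m * ((j%:R - m%:R) * (j%:R + m%:R + a + b%:R + 1))))
  = - bessel_coef R b m *
    (jacobi_fact a b j m * ((j%:R - m%:R) * (j%:R + m%:R + a + b%:R + 1))).
  by rewrite -(bessel_coefS2 R b m) -mulrN -bessel_coefS; ring.
rewrite /jacobi_eigen; ring.
Qed.

(** The first factor of [jacobi_fact a b j.+1] is the eigenvalue; the later ones are the factors for
    [a + 1], [b + 1] and degree [j]. *)
Lemma jacobi_poly_deriv (R : realType) (a : R) (b j : nat) :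
  (jacobi_poly a b j.+1)^`()
  = - jacobi_eigen a b j.+1 *: jacobi_poly (a + 1) b.+1 j.
Proof.
apply/polyP => m; rewrite coef_deriv coefZ !coef_jacobi_poly.
rewrite -[LHS]mulr_natl mulrA bessel_coefS.
have -> : jacobi_fact a b j.+1 m.+1
    = jacobi_eigen a b j.+1 * jacobi_fact (a + 1) b.+1 j m.
  rewrite /jacobi_fact big_ord_recl /jacobi_eigen; congr (_ * _).
    by rewrite subr0 addr0.
  by apply: eq_bigr => i _; rewrite /= /bump/= -!natr1; ring.
ring.
Qed.

(** By symmetry both eigenvalues give the same multiple of the integral, and they differ by
    [(i - j) * (i + j + a + b + 1)], which is nonzero. *)
Lemma jacobi_poly_orth (R : realType) (a : R) (b i j : nat) : 0 <= a ->
  i != j -> jint a ('X^b * jacobi_poly a b i * jacobi_poly a b j) = 0.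
Proof.
move=> a0 ij.
have h k l : jint a ('X^b * jacobi_op a b (jacobi_poly a b k) * jacobi_poly a b l)
  = - jacobi_eigen a b k * jint a ('X^b * jacobi_poly a b k * jacobi_poly a b l).
  by rewrite jacobi_poly_eigen -scalerAr -scalerAl linearZ.
have h1 := h i j; have h2 := h j i.
rewrite jacobi_op_sym// in h1; rewrite jacobi_op_sym// in h2.
have e : jacobi_eigen a b i != jacobi_eigen a b j.
  rewrite -subr_eq0 /jacobi_eigen.
  have -> : i%:R * (i%:R + a + b%:R + 1) - j%:R * (j%:R + a + b%:R + 1)
    = (i%:R - j%:R) * (i%:R + j%:R + a + b%:R + 1) by ring.
  rewrite mulf_neq0//; first by rewrite subr_eq0 eqr_nat.
  by rewrite gt_eqF// ltr_wpDl// !addr_ge0.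
rewrite [_ * _ * (jacobi_poly a b i)^`()]mulrAC h1 in h2.
rewrite [_ * _ * jacobi_poly a b i]mulrAC in h2; move/eqP: h2.
rewrite -subr_eq0 -mulrBl mulf_eq0 subr_eq0 eqr_opp (negbTE e)/=.
by move=> /eqP.
Qed.

(** The Beta integral [B(a + 1, b + 1)]. Applying [jint_deriv] to ['X^(b.+1)] gives the recurrence
    in [b]. *)
Lemma jint_Xn (R : realType) (a : R) (b : nat) : 0 <= a ->
  jint a 'X^b = b`!%:R / \prod_(i < b.+1) (a + i.+1%:R).
Proof.
move=> a0; have D k : a + k.+1%:R != 0 by rewrite gt_eqF// ltr_wpDl.
elim: b => [|b IH].
  rewrite big_ord_recl big_ord0 mulr1 fact0 div1r.
  have := @jint_deriv R a 1 a0; rewrite -polyC1 derivC mulr0 sub0r mulr1.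
  rewrite hornerC linearN/= => /eqP; rewrite eqr_opp -[(a + 1)%:P]mulr1.
  rewrite mul_polyC linearZ/= => /eqP e.
  by apply: (mulfI (D 0)); rewrite mulfV// expr0.
have e := @jint_deriv R a 'X^(b.+1) a0.
rewrite hornerXn expr0n/= oppr0 derivXn /= in e.
have {}e : (a + b.+2%:R) * jint a 'X^(b.+1) = b.+1%:R * jint a 'X^b.
  apply/eqP; rewrite eq_sym -subr_eq0 -[X in _ == X]e.
  apply/eqP; rewrite -!linearZ -linearB/=; congr jint.
  rewrite -!mul_polyC -(mulr_natl 'X^b) -polyC_natr exprS.
  rewrite -[b.+2%:R]natr1 !polyCD; move: 'X^b => Xb; ring.
apply: (mulfI (D b.+1)); rewrite e IH [\prod_(i < b.+2) _]big_ord_recr/=.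
rewrite factS natrM invfM; move: (\prod_(i < _) _)^-1 => P.
by rewrite -[LHS](mulfK (D b.+1)); ring.
Qed.

(** Since [b] is an integer, the usual Gamma quotient [Gamma(j+b+1) Gamma(j+a+b+1) / (Gamma(j+1)
    Gamma(j+a+1))] is a finite product. *)
Definition jacobi_sqnorm_inv (R : realType) (a : R) (b j : nat) : R :=
  (2 * j%:R + a + b%:R + 1)
  * \prod_(i < b) ((j%:R + i.+1%:R) * (j%:R + a + i.+1%:R)).

Lemma jacobi_sqnorm_inv_gt0 (R : realType) (a : R) (b j : nat) : 0 <= a ->
  0 < jacobi_sqnorm_inv a b j.
Proof.
move=> a0; apply: mulr_gt0; first by rewrite ltr_wpDl// !addr_ge0// mulr_ge0.
by apply: prodr_gt0 => i _; apply: mulr_gt0; rewrite ltr_wpDl ?addr_ge0.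
Qed.

(** Taking [q = r] in [jacobi_op_sym] and inserting [jacobi_poly_deriv] shows that the squared norm
    in degree [j.+1] is the eigenvalue times the one in degree [j] for [a + 1], [b + 1]. Degree 0 is
    the Beta integral. *)
Lemma jacobi_poly_norm (R : realType) (a : R) (b j : nat) : 0 <= a ->
  jint a ('X^b * jacobi_poly a b j * jacobi_poly a b j)
  = (jacobi_sqnorm_inv a b j)^-1.
Proof.
elim: j a b => [|j IH] a b a0.
  have -> : jacobi_poly a b 0 = (b`!%:R^-1)%:P.
    apply/polyP => m; rewrite coef_jacobi_poly coefC.
    case: m => [|m]/=; last by rewrite jacobi_fact_eq0// mulr0.
    by rewrite /bessel_coef /jacobi_fact big_ord0 mulr1 fact0 mulr1 div1r.
  rewrite -mulrA -polyCM mulrC mul_polyC linearZ/= jint_Xn//.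
  rewrite /jacobi_sqnorm_inv mulr0 add0r big_split/=.
  have -> : \prod_(i < b) ((0 : R) + i.+1%:R) = b`!%:R.
    under eq_bigr do rewrite add0r.
    elim: b => [|b IH]; first by rewrite big_ord0.
    by rewrite big_ord_recr/= IH factS natrM mulrC.
  have b0 : b`!%:R != 0 :> R by rewrite pnatr_eq0 -lt0n fact_gt0.
  rewrite mulrA divfK// big_ord_recr/= !invfM -natr1 addrA.
  by rewrite [RHS]mulrC mulrA.
have l0 : jacobi_eigen a b j.+1 != 0.
  by rewrite mulf_neq0// gt_eqF// ltr_wpDl// !addr_ge0.
have a10 : 0 <= a + 1 by rewrite addr_ge0.
have := @jacobi_op_sym R a b (jacobi_poly a b j.+1) (jacobi_poly a b j.+1) a0.
rewrite jacobi_poly_eigen jacobi_poly_deriv.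
(* The left side carries [l] once and the right side twice; here [l] is minus the eigenvalue. *)
have h (l : R) : l != 0 -> forall P Q : {poly R},
    jint a ('X^b * (l *: P) * P)
    = - jint (a + 1) ('X^(b.+1) * (l *: Q) * (l *: Q)) ->
    jint a ('X^b * P * P) = - l * jint (a + 1) ('X^(b.+1) * Q * Q).
  move=> l1 P Q; rewrite -!scalerAr -!scalerAl !linearZ/= => e.
  by apply: (mulfI l1); rewrite e mulNr -mulrN.
move=> /h ->; last by rewrite oppr_eq0.
rewrite opprK IH//.
have -> : jacobi_sqnorm_inv a b j.+1
    = jacobi_sqnorm_inv (a + 1) b.+1 j / jacobi_eigen a b j.+1.
  apply: (mulIf l0); rewrite divfK// /jacobi_sqnorm_inv !big_split/=.
  rewrite [\prod_(i < b.+1) (_ + i.+1%:R)]big_ord_recl.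
  rewrite [\prod_(i < b.+1) _]big_ord_recr/= /jacobi_eigen.
  rewrite (_ : \prod_(i < b) (j%:R + (bump 0 i).+1%:R)
    = \prod_(i < b) (j.+1%:R + i.+1%:R)); last first.
    by apply: eq_bigr => i _; rewrite /bump/= -!natr1; ring.
  rewrite (_ : \prod_(i < b) (j%:R + (a + 1) + i.+1%:R)
    = \prod_(i < b) (j.+1%:R + a + i.+1%:R)); last first.
    by apply: eq_bigr => i _; rewrite -!natr1; ring.
  move: (\prod_(i < b) _) => U; move: (\prod_(i < b) _) => V.
  rewrite -!natr1; ring.
by rewrite invf_div.
Qed.

(** * Identification of an arbitrary orthonormal family *)

Lemma poly_family_span (R : realType) (p : nat -> {poly R}) n (q : {poly R}) :
  (forall j, size (p j) = j.+1) -> (size q <= n)%N ->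
  exists c : nat -> R, q = \sum_(i < n) c i *: p i.
Proof.
move=> hp; elim: n q => [|n IH] q qn.
  exists (fun=> 0); rewrite big_ord0; apply/eqP.
  by rewrite -size_poly_eq0 -leqn0.
have pn0 : (p n)`_n != 0.
  have := lead_coef_eq0 (p n); rewrite lead_coefE hp/= => ->.
  by rewrite -size_poly_eq0 hp.
pose l := q`_n / (p n)`_n.
have [|c hc] := IH (q - l *: p n).
  apply/leq_sizeP => k; rewrite leq_eqVlt => /predU1P[<-|nk].
    by rewrite coefB coefZ divfK// subrr.
  by rewrite coefB coefZ !nth_default ?hp// ?mulr0 ?subrr// (leq_trans qn).
exists (fun i => if i == n then l else c i); rewrite big_ord_recr/= eqxx.
rewrite -[LHS](subrK (l *: p n)) hc; congr (_ + _).
by apply: eq_bigr => i _; rewrite (ltn_eqF (ltn_ord i)).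
Qed.

(** Being orthogonal to all lower degrees, [jacobi_poly a b j] is a multiple of [p j]. The norms
    determine only the square of the factor, which is enough for a product of two values. [kappa]
    absorbs the constant of the change of variable. *)
Lemma orthonormal_jacobi_poly (R : realType) (a kappa : R) (b j : nat)
    (p : nat -> {poly R}) : 0 <= a ->
  (forall j, size (p j) = j.+1) ->
  (forall i j, kappa * jint a ('X^b * p i * p j) = (i == j)%:R) ->
  forall s t, (p j).[s] * (p j).[t] =
    jacobi_sqnorm_inv a b j / kappa
    * ((jacobi_poly a b j).[s] * (jacobi_poly a b j).[t]).
Proof.
move=> a0 hs hp.
have k0 : kappa != 0.
  by apply/eqP => k0; have /eqP := hp 0 0; rewrite k0 mul0r eqxx eq_sym oner_eq0.
have w0 := @jacobi_sqnorm_inv_gt0 R a b j a0.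
have orth (q : {poly R}) : (size q <= j)%N -> jint a ('X^b * q * jacobi_poly a b j) = 0.
  move=> /(@poly_family_span R (jacobi_poly a b) j q).
  move=> []; first by move=> k; apply: size_jacobi_poly.
  move=> c ->; rewrite mulr_sumr mulr_suml linear_sum/= big1// => i _.
  by rewrite -scalerAr -scalerAl linearZ/= jacobi_poly_orth ?mulr0// ltn_eqF.
have [|c hc] := @poly_family_span R p j.+1 (jacobi_poly a b j) hs.
  by rewrite size_jacobi_poly.
have c0 (i : 'I_j) : c i = 0.
  have := orth (p i); rewrite hs ltn_ord => /(_ isT).
  rewrite hc mulr_sumr linear_sum/= (bigD1 (widen_ord (leqnSn j) i))//= big1.
    rewrite addr0 -scalerAr linearZ/=.
    move=> /(congr1 (fun x => kappa * x)); rewrite mulrCA hp eqxx mulr1 mulr0.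
    by [].
  move=> k ki; rewrite -scalerAr linearZ/=; apply/(mulfI k0).
  rewrite mulrCA hp mulr0; case: eqP; rewrite ?mulr0// => e.
  by case/negP: ki; apply/eqP/val_inj.
have {}hc : jacobi_poly a b j = c j *: p j.
  rewrite hc big_ord_recr/= big1 ?add0r// => i _.
  by rewrite c0 scale0r.
have hcc : c j * c j = kappa / jacobi_sqnorm_inv a b j.
  rewrite -(@jacobi_poly_norm R a b j a0) hc.
  have -> : jint a ('X^b * (c j *: p j) * (c j *: p j))
      = c j * (c j * jint a ('X^b * p j * p j)).
    by rewrite -!scalerAr -!scalerAl !linearZ.
  by rewrite mulrCA [kappa * _]mulrCA hp eqxx mulr1.
move=> s t; rewrite hc !hornerZ [c j * _ * _]mulrACA hcc !mulrA.
by rewrite divfK// divff ?mul1r// lt0r_neq0.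
Qed.

(** * The explicit kernel *)

Lemma is_derive_powR_sub1 (R : realType) (c x : R) : x < 1 ->
  is_derive x 1 (fun y : R => (1 - y) `^ c) (- (c * (1 - x) `^ (c - 1))).
Proof.
move=> x1; have x10 : 0 < 1 - x by rewrite subr_gt0.
have := @is_derive1_comp R ((@powR R)^~ c) (fun y => 1 - y) x _ (-1)
  (@is_derive1_powR R c _ x10).
rewrite mulrN1; apply.
by rewrite -[X in is_derive _ _ _ X]sub0r; apply: is_deriveB.
Qed.

(** For [c = 0] the function is constantly 1, even at the endpoint; for [c > 0] the limit is 0. *)
Lemma powR_sub1_cvg (R : realType) (c : R) : 0 <= c ->
  (1 - x) `^ c @[x --> (1 : R)^'-] --> (1 - 1 : R) `^ c.
Proof.
rewrite le_eqVlt => /predU1P[<-|c0].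
  by rewrite powRr0; under eq_fun do rewrite powRr0; exact: cvg_cst.
rewrite subrr powR0 ?gt_eqF//.
have h : (1 - x : R) @[x --> (1 : R)^'-] --> (0 : R)^'+.
  move=> B [e /= e0 hB]; exists e => //= y /= y1 ylt; apply: hB.
    by move: y1; rewrite /ball_/= sub0r normrN.
  by rewrite /= subr_gt0.
exact: (cvg_comp _ _ h (powR_cvg0 c0)).
Qed.

Lemma powR_sub1_continuous (R : realType) (c x : R) : x < 1 ->
  {for x, continuous (fun y : R => (1 - y) `^ c)}.
Proof.
move=> /(@is_derive_powR_sub1 R c x) h.
by apply/differentiable_continuous/derivable1_diffP; case: h.
Qed.

(** The constant is that of the substitution [x = 2 * t - 1], but the proof uses an explicit
    primitive and the fundamental theorem of calculus. *)
Lemma jacobi_integral (R : realType) (a : R) (b : nat) (q : {poly R}) :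
  0 <= a ->
  (\int[@lebesgue_measure R]_(x in `[(-1), 1])
     (q.[x] * jacobi_weight a b%:R x))%R
  = 2 `^ (a + 1) * 2 ^+ b * jint a ('X^b * (q \Po (2%:R *: 'X - 1))).
Proof.
move=> a0; have a10 : 0 <= a + 1 by rewrite addr_ge0.
set r := 'X^b * _; rewrite /jint; set s := r \Po _.
(* [S] solves ['X * S' + (a + 1) * S = s] coefficient by coefficient. *)
pose S : {poly R} := \poly_(k < size s) (s`_k / (a + k.+1%:R)).
have S1 : S.[1] = moment a s.
  rewrite (@horner_coef_wide _ (size s)) ?size_poly// /moment.
  by apply: eq_bigr => k _; rewrite expr1n mulr1 coef_poly ltn_ord.
have Ss : 'X * S^`() + (a + 1)%:P * S = s.
  apply/polyP => k; rewrite coefD coefXM coefCM coef_deriv.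
  have -> : (if k == 0%N then 0 else S`_k.-1.+1 *+ k.-1.+1) = k%:R * S`_k.
    by case: k => [|k]; rewrite ?mul0r//= mulr_natl.
  rewrite -mulrDl coef_poly; case: ltnP => sk; last first.
    by rewrite nth_default// mulr0.
  rewrite mulrC -[RHS](divfK (_ : a + k.+1%:R != 0)).
    by congr (_ * _); rewrite -natr1; ring.
  by rewrite gt_eqF// ltr_wpDl.
pose h : {poly R} := 2^-1 *: (1 - 'X).
have sh x : s.[(1 - x) / 2] = (((1 + x) / 2) ^+ b) * q.[x].
  rewrite /s /r !horner_comp hornerM hornerXn horner_comp !hornerE.
  by congr (_ ^+ b * q.[_]); field.
pose g (x : R) := (2 ^+ b *: (s \Po h)).[x] * (1 - x) `^ a.
(* Up to a constant, this is the primitive [y ^ (a + 1) * S(y)] behind [moment_deriv], at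
   [y = (1 - x) / 2]. *)
pose G (x : R) : R := (- 2 ^+ b *: (S \Po h)).[x] * (1 - x) `^ (a + 1).
have -> : (\int[@lebesgue_measure R]_(x in `[(-1), 1])
     (q.[x] * jacobi_weight a b%:R x))%R =
    (\int[@lebesgue_measure R]_(x in `[(-1), 1]) g x)%R.
  apply: eq_Rintegral => x; rewrite inE/= in_itv/= => /andP[x1 x2].
  rewrite /jacobi_weight /g hornerZ horner_comp.
  have -> : h.[x] = (1 - x) / 2 by rewrite !hornerE mulrC.
  rewrite sh powR_mulrn; last by rewrite -lerBlDl sub0r.
  rewrite [2 ^+ b * _]mulrA -exprMn [2 * _]mulrC divfK//.
  by rewrite mulrCA [RHS]mulrC; congr (_ * _); rewrite mulrC.
have lt11 : (-1 : R) < 1 by lra.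
have cp (p : {poly R}) (c : R) : 0 <= c ->
    {within `[(-1), 1], continuous (fun x : R => p.[x] * (1 - x) `^ c)}.
  move=> c0; apply/continuous_within_itvP => //; split.
  - move=> x; rewrite in_itv/= => /andP[_ x1].
    by apply: continuousM; [exact: continuous_horner|exact: powR_sub1_continuous].
  - apply: cvg_at_right_filter.
    by apply: continuousM; [exact: continuous_horner|exact: powR_sub1_continuous].
  - apply: cvgM; last exact: powR_sub1_cvg.
    by apply: cvg_at_left_filter; exact: continuous_horner.
have dG (x : R) : x < 1 -> is_derive x 1 G (g x).
  move=> x1; have := is_derive_powR_sub1 (a + 1) x1.
  move=> /(is_deriveM (is_derive_poly (- 2 ^+ b *: (S \Po h)) x)) H.
  have a11 : 0 < a + 1 by rewrite ltr_wpDl.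
  apply: (is_derive_eq H); rewrite addrK powRD ?[a + 1 == 0]gt_eqF//.
  rewrite powRr1 ?subr_ge0 ?ltW// /g -Ss derivZ deriv_comp /h derivZ derivB.
  rewrite derivX -[1 in X in X - 1](polyC1) derivC sub0r !hornerE !horner_comp.
  rewrite !hornerE /GRing.scale/=.
  by field.
have cG := cp (- 2 ^+ b *: (S \Po h)) (a + 1) a10.
have G1 : derivable_oo_LRcontinuous G (-1) 1.
  split; first by move=> x; rewrite in_itv/= => /andP[_ /dG[]].
    by have /(@continuous_within_itvP _ _ _ _ _ _ lt11)[] := cG.
  by have /(@continuous_within_itvP _ _ _ _ _ _ lt11)[] := cG.
have G2 : {in `](-1), 1[, derive1 G =1 g}.
  move=> x; rewrite in_itv/= derive1E => /andP[_ /dG Gx].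
  by rewrite derive_val.
have := @continuous_FTC2 R g G (-1) 1 lt11 (cp _ _ a0) G1 G2.
rewrite /Rintegral => ->.
(* As [a + 1 > 0], [G] vanishes at 1 and only the endpoint -1, where [y = 1], contributes. *)
rewrite /= /G subrr opprK powR0 ?mulr0; last by rewrite gt_eqF// ltr_wpDl.
rewrite -S1 hornerZ horner_comp !hornerE.
have -> : 2^-1 * (1 - -1) = 1 :> R by field.
have -> : 1 + 1 = 2 :> R by [].
ring.
Qed.

Lemma orthonormal_jacobi_explicit (R : realType) (a : R) (b : nat)
    (p : nat -> {poly R}) : 0 <= a -> orthonormal_jacobi a b%:R p ->
  forall j s t, (p j).[2 * s - 1] * (p j).[2 * t - 1] =
    jacobi_sqnorm_inv a b j / (2 `^ (a + 1) * 2 ^+ b)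
    * ((jacobi_poly a b j).[s] * (jacobi_poly a b j).[t]).
Proof.
move=> a0 [hs hp] j s t; pose h : {poly R} := 2%:R *: 'X - 1.
have hE x : h.[x] = 2 * x - 1 by rewrite !hornerE.
have h2 : size h = 2.
  rewrite /h -polyC1 size_polyDl; first by rewrite size_scale ?size_polyX// pnatr_eq0.
  by rewrite size_polyN size_polyC oner_neq0 size_scale ?size_polyX// pnatr_eq0.
have := @orthonormal_jacobi_poly R a (2 `^ (a + 1) * 2 ^+ b) b j
  (fun i => p i \Po h) a0.
have hs' i : size (p i \Po h) = i.+1 by rewrite size_comp_poly2.
move=> /(_ hs') H; rewrite -H; first by rewrite !horner_comp !hE.
move=> i k; rewrite -['X^b * _ * _]mulrA -comp_polyM.
rewrite -(@jacobi_integral R a b (p i * p k) a0) -hp.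
by apply: eq_Rintegral => x _; rewrite hornerM.
Qed.

(** * The kernel in the scaled variables *)

Definition jacobi_scale (R : realType) (a : R) (n : nat) : R :=
  n%:R * (n%:R + a).

(** Of the power [N ^ b.+1], [b] factors come from the two weights and one from the prefactor of the
    rescaled kernel. *)
Definition jacobi_sum (R : realType) (a : R) (b n : nat) (x y : R) : R :=
  let N := jacobi_scale a n in
  \sum_(j < n) jacobi_sqnorm_inv a b j / N ^+ b.+1
    * ((jacobi_poly a b j).[x / N] * (jacobi_poly a b j).[y / N]).

(** The square root of the weight without its constants: the first factor tends to 1, the second is
    the [x ^ (b / 2)] of the Bessel function. *)
Definition edge_factor (R : realType) (a : R) (b n : nat) (x : R) : R :=
  Num.sqrt ((1 - x / jacobi_scale a n) `^ a) * Num.sqrt (x ^+ b).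

Lemma jacobi_scale_gt0 (R : realType) (a : R) (n : nat) : 0 <= a ->
  (0 < n)%N -> 0 < jacobi_scale a n.
Proof. by move=> a0 n0; rewrite mulr_gt0 ?ltr0n// ltr_wpDr// ltr0n. Qed.

Lemma sqrt_jacobi_weight (R : realType) (a : R) (b n : nat) (x : R) :
  0 <= a -> (0 < n)%N -> 0 <= x <= jacobi_scale a n ->
  Num.sqrt (jacobi_weight a b%:R (2 * (x / jacobi_scale a n) - 1))
  = Num.sqrt (2 `^ a * (2 / jacobi_scale a n) ^+ b) * edge_factor a b n x.
Proof.
move=> a0 n0 /andP[x0 xN]; have N0 := jacobi_scale_gt0 a0 n0.
rewrite /edge_factor /jacobi_weight; set N := jacobi_scale a n in xN N0 *.
have h0 : 0 <= 1 - x / N by rewrite subr_ge0 ler_pdivrMr// mul1r.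
rewrite -sqrtrM ?powR_ge0// -sqrtrM; last first.
  by rewrite mulr_ge0 ?powR_ge0// exprn_ge0// divr_ge0// ltW.
congr Num.sqrt.
have -> : 1 - (2 * (x / N) - 1) = 2 * (1 - x / N) by ring.
have -> : 1 + (2 * (x / N) - 1) = 2 / N * x by ring.
rewrite powRM// powR_mulrn; last by rewrite mulr_ge0 ?divr_ge0// ltW.
by rewrite exprMn; ring.
Qed.

(** The bounds on [x] and [y] keep the arguments in [[-1, 1]]. Of the powers of 2 only [4^-1]
    survives: one half from the scale [2 * N], the other from [2 ^ a] against [2 ^ (a + 1)]. *)
Lemma rescaled_jacobi_kernelE (R : realType) (a : R) (b n : nat)
    (p : nat -> {poly R}) (x y : R) : 0 <= a -> (0 < n)%N ->
  orthonormal_jacobi a b%:R p ->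
  0 <= x <= jacobi_scale a n -> 0 <= y <= jacobi_scale a n ->
  rescaled_jacobi_kernel a b%:R p n (4 * x) (4 * y)
  = 4^-1 * (edge_factor a b n x * edge_factor a b n y * jacobi_sum a b n x y).
Proof.
move=> a0 n0 op hx hy; have N0 := jacobi_scale_gt0 a0 n0.
have n0' : n%:R != 0 :> R by rewrite pnatr_eq0 -lt0n.
rewrite /rescaled_jacobi_kernel.
have -> : 2 * n%:R ^+ 2 * (1 + a / n%:R) = 2 * jacobi_scale a n.
  by rewrite /jacobi_scale; field.
rewrite /jacobi_sum; set N := jacobi_scale a n in hx hy N0 *.
have N0' : N != 0 by rewrite gt_eqF.
have tE z : -1 + 4 * z / (2 * N) = 2 * (z / N) - 1 by field.
rewrite !tE /jacobi_kernel !sqrt_jacobi_weight// -/N.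
under eq_bigr do rewrite (orthonormal_jacobi_explicit a0 op).
set E := edge_factor a b n x; set F := edge_factor a b n y.
set S := Num.sqrt (2 `^ a * _).
have SS : S * S = 2 `^ a * (2 / N) ^+ b.
  rewrite -expr2 sqr_sqrtr// mulr_ge0 ?powR_ge0// exprn_ge0// divr_ge0// ltW//.
have -> : S * E * (S * F) = S * S * (E * F) by ring.
rewrite SS !mulr_sumr; apply: eq_bigr => j _.
have a11 : 0 < a + 1 by rewrite ltr_wpDl.
rewrite powRD ?[a + 1 == 0]gt_eqF// powRr1// exprMn exprVn exprS.
have A0 : 2 `^ a != 0 :> R by rewrite gt_eqF// powR_gt0.
have B0 : 2 ^+ b != 0 :> R by rewrite expf_neq0.
have C0 : N ^+ b != 0 :> R by rewrite expf_neq0.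
move: (2 `^ a) (2 ^+ b) (N ^+ b) A0 B0 C0 => A B C A0 B0 C0.
move: (jacobi_sqnorm_inv _ _ _) => W; move: (_.[_] * _) => PP.
field.
by rewrite A0 B0 C0 N0'.
Qed.

(** * Power series of the Bessel function *)

Lemma bessel_coef_le (R : realType) (b m : nat) :
  `|bessel_coef R b m| <= m`!%:R^-1.
Proof.
rewrite /bessel_coef normrM normrX normrN1 expr1n mul1r normfV ger0_norm//.
rewrite lef_pV2 ?posrE ?mulr_gt0 ?ltr0n ?fact_gt0// ler_peMl//.
by rewrite (ler_nat _ 1) fact_gt0.
Qed.

Lemma sum_exp_le (R : realType) (z : R) n : 0 <= z ->
  \sum_(0 <= m < n) z ^+ m / m`!%:R <= expR z.
Proof.
move=> z0; have := @nondecreasing_cvgn_le R (series (exp_coeff z)).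
apply; last exact: is_cvg_series_exp_coeff.
by apply: nondecreasing_series => k _ _; exact: exp_coeff_ge0.
Qed.

Definition bessel_phi (R : realType) (b : nat) (x : R) : R :=
  limn (pseries (bessel_coef R b) x).

Lemma is_cvg_bessel_phi (R : realType) (b : nat) (x : R) :
  cvgn (pseries (bessel_coef R b) x).
Proof.
apply: normed_cvg; apply: series_le_cvg (is_cvg_series_exp_coeff `|x|).
- by move=> n /=.
- by move=> n; exact: exp_coeff_ge0.
move=> n /=; rewrite normrM normrX /exp_coeff/= mulrC.
by rewrite ler_wpM2l ?exprn_ge0// bessel_coef_le.
Qed.

Lemma bessel_phi_cvg (R : realType) (b : nat) (x : R) :
  \sum_(0 <= m < n) bessel_coef R b m * x ^+ m @[n --> \oo] --> bessel_phi b x.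
Proof. exact: is_cvg_bessel_phi. Qed.

(** Termwise differentiation: by [bessel_coefS] the derived series are again of the same kind, so
    they converge at every radius. *)
Lemma is_derive_bessel_phi (R : realType) (b : nat) (x : R) :
  is_derive x 1 (@bessel_phi R b) (- bessel_phi b.+1 x).
Proof.
have E c : pseries_diffs (bessel_coef R c) = - bessel_coef R c.+1.
  by apply/funext => m; rewrite /pseries_diffs bessel_coefS.
have N c z : pseries (- bessel_coef R c) z = - pseries (bessel_coef R c) z.
  rewrite /pseries -seriesN; congr series.
  by apply/funext => i; exact: mulNr.
have -> : - bessel_phi b.+1 x = limn (pseries (pseries_diffs (bessel_coef R b)) x).
  by rewrite E N limN//; exact: is_cvg_bessel_phi.
apply: (@pseries_snd_diffs R (bessel_coef R b) (`|x| + 1) x).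
- exact: is_cvg_bessel_phi.
- by rewrite E N is_cvgNE; exact: is_cvg_bessel_phi.
- by rewrite E pseries_diffsN E opprK; exact: is_cvg_bessel_phi.
by rewrite [ltRHS]ger0_norm ?addr_ge0// ltrDl.
Qed.

(** Bessel's equation [x * phi'' + (b + 1) * phi' + phi = 0], with [phi' = - phi_(b+1)] and
    [phi'' = phi_(b+2)]. *)
Lemma bessel_phi_ode (R : realType) (b : nat) (x : R) :
  bessel_phi b x = b.+1%:R * bessel_phi b.+1 x - x * bessel_phi b.+2 x.
Proof.
pose T c n := \sum_(0 <= m < n) bessel_coef R c m * x ^+ m.
(* The factor [x] raises the degree by one, so the last partial sum has one term fewer. *)
have E n : T b n.+1 = b.+1%:R * T b.+1 n.+1 - x * T b.+2 n.
  rewrite /T [in X in _ - X]mulr_sumr -sumrN /=.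
  rewrite mulr_sumr !big_nat_recl// -addrA -big_split/= !expr0 !mulr1.
  rewrite -(bessel_coefS2 R b 0) add0n; congr (_ + _).
  apply: eq_bigr => m _; rewrite -(bessel_coefS2 R b m.+1).
  have e := bessel_coefS R b.+1 m; rewrite exprS.
  rewrite [in RHS]mulrCA -mulrN -mulNr -e -natr1 natrD -natr1 -[b.+1%:R]natr1.
  ring.
have L c : T c n.+1 @[n --> \oo] --> bessel_phi c x.
  by have := @bessel_phi_cvg R c x; rewrite -(cvg_shiftS (T c)).
have L2 : T b n.+1 @[n --> \oo] -->
    b.+1%:R * bessel_phi b.+1 x - x * bessel_phi b.+2 x.
  under eq_fun do rewrite E.
  by apply: cvgB; apply: cvgMr => //; exact: bessel_phi_cvg.
by rewrite -(cvg_lim _ (L b))// (cvg_lim _ L2).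
Qed.

Lemma bessel_phi_le (R : realType) (b : nat) (x : R) :
  `|bessel_phi b x| <= expR `|x|.
Proof.
apply: (cvgr_to_le (cvg_norm (@bessel_phi_cvg R b x))).
near=> n; rewrite (le_trans (ler_norm_sum _ _ _))//.
rewrite (le_trans _ (@sum_exp_le R `|x| n _))//; apply: ler_sum => m _.
by rewrite normrM normrX mulrC ler_wpM2l ?exprn_ge0// bessel_coef_le.
Unshelve. all: by end_near. Qed.

(** * The Bessel kernel as a value of an explicit primitive *)

Lemma bessel_JE (R : realType) (b : nat) (z : R) :
  bessel_J b z = (z / 2) ^+ b * bessel_phi b ((z / 2) ^+ 2).
Proof.
rewrite /bessel_J /bessel_phi /pseries; congr (_ * _).
by under eq_fun do rewrite exprM.
Qed.

(* The Wronskian of [q => bessel_phi b (q * x)] and [q => bessel_phi b (q * y)],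
   weighted by [q ^ (b + 1)]; note that [bessel_phi b] has derivative
   [- bessel_phi b.+1]. *)
Definition bessel_primitive (R : realType) (b : nat) (x y q : R) : R :=
  q ^+ b.+1 * (x * (bessel_phi b (q * y) * bessel_phi b.+1 (q * x))
               - y * (bessel_phi b (q * x) * bessel_phi b.+1 (q * y))) / (x - y).

Lemma is_derive_bessel_phi_scale (R : realType) (b : nat) (x q : R) :
  is_derive q 1 (fun r => bessel_phi b (r * x))
    (- x * bessel_phi b.+1 (q * x)).
Proof.
have h : is_derive q 1 (fun r : R => r * x) x.
  have := @is_deriveM R R id (cst x) q 1 1 0 (is_derive_id _ _) (is_derive_cst _ _ _).
  by move=> H; apply: (is_derive_eq H); rewrite scaler0 add0r; exact: mulr1.
have := @is_derive1_comp R (bessel_phi b) (fun r => r * x) q _ x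
  (is_derive_bessel_phi b (q * x)) h.
by move=> H; apply: (is_derive_eq H); rewrite mulrC mulrN mulNr.
Qed.

(** For [f(q) = phi_b(q * x)], Bessel's equation reads [(q ^ (b + 1) * f')' = - x * q ^ b * f]. In
    the derivative of the Wronskian the products of first derivatives cancel, leaving
    [(x - y) * q ^ b] times the two functions. *)
Lemma is_derive_bessel_primitive (R : realType) (b : nat) (x y q : R) :
  x != y ->
  is_derive q 1 (bessel_primitive b x y)
    (q ^+ b * (bessel_phi b (q * x) * bessel_phi b (q * y))).
Proof.
move=> xy; have xy0 : x - y != 0 by rewrite subr_eq0.
have D c z := is_derive_bessel_phi_scale c z q.
have H1 := is_deriveZ x (is_deriveM (D b y) (D b.+1 x)).
have H2 := is_deriveZ y (is_deriveM (D b x) (D b.+1 y)).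
have H3 : is_derive q 1 (fun r : R => r ^+ b.+1) (b.+1%:R * q ^+ b).
  have := is_deriveX b.+1 (is_derive_id q (1 : R)); rewrite exprfctE => H.
  by apply: (is_derive_eq H); exact: mulr1.
have H := is_deriveZ (x - y)^-1 (is_deriveM H3 (is_deriveB H1 H2)).
have -> : bessel_primitive b x y = (fun r => (x - y)^-1 *
   (r ^+ b.+1 * (x * (bessel_phi b (r * y) * bessel_phi b.+1 (r * x))
               - y * (bessel_phi b (r * x) * bessel_phi b.+1 (r * y))))).
  by apply/funext => r; rewrite /bessel_primitive mulrC.
apply: (is_derive_eq H).
rewrite -[(_ - _) q]/(x * (bessel_phi b (q * y) * bessel_phi b.+1 (q * x))
  - y * (bessel_phi b (q * x) * bessel_phi b.+1 (q * y))).
rewrite (bessel_phi_ode b (q * x)) (bessel_phi_ode b (q * y)).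
rewrite /GRing.scale/=.
set A1 := bessel_phi b.+1 (q * x); set B1 := bessel_phi b.+1 (q * y).
set A2 := bessel_phi b.+2 (q * x); set B2 := bessel_phi b.+2 (q * y).
rewrite exprS; by move: (q ^+ b) => Q; field.
Qed.

Lemma is_derive_bessel_J (R : realType) (b : nat) (z : R) : 0 < z ->
  is_derive z 1 (@bessel_J R b)
    ((z / 2) ^+ b * (b%:R * bessel_phi b ((z / 2) ^+ 2)
      - 2 * (z / 2) ^+ 2 * bessel_phi b.+1 ((z / 2) ^+ 2)) / z).
Proof.
move=> z0.
have -> : @bessel_J R b =
    (fun w => ((2^-1 *: 'X) ^+ b).[w] * bessel_phi b ((4^-1 *: 'X^2).[w])).
  apply/funext => w; rewrite bessel_JE horner_exp !hornerZ hornerX hornerXn.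
  by congr (_ ^+ _ * bessel_phi _ _); rewrite ?(mulrC _ w)//; field.
have H := is_deriveM (is_derive_poly ((2^-1 *: 'X) ^+ b) z)
  (is_derive1_comp (is_derive_bessel_phi b (4^-1 *: 'X^2).[z])
    (is_derive_poly (4^-1 *: 'X^2) z)).
apply: (is_derive_eq H).
have e4 : (4^-1 *: 'X^2).[z] = (z / 2) ^+ 2 by rewrite hornerZ hornerXn; field.
rewrite -[(_ \o _) z]/(bessel_phi b (4^-1 *: 'X^2).[z]) e4.
have d1 : ((2^-1 *: 'X) ^+ b)^`().[z] = b%:R * (2^-1 * (z / 2) ^+ b.-1).
  rewrite deriv_exp hornerMn hornerM horner_exp derivZ derivX !hornerZ hornerX.
  by rewrite hornerC mulr1 mulr_natl [z / 2]mulrC.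
have d2 : (4^-1 *: 'X^2)^`().[z] = z / 2.
  by rewrite derivZ derivXn hornerZ hornerMn hornerX -mulr_natl; field.
have d0 : ((2^-1 *: 'X) ^+ b).[z] = (z / 2) ^+ b.
  by rewrite horner_exp hornerZ hornerX mulrC.
rewrite d0 d1 d2 /GRing.scale/=.
have z0' : z != 0 by rewrite gt_eqF.
move: (bessel_phi b _) (bessel_phi b.+1 _) => F G.
(* The derivative of the power involves [b.-1]; for [b = 0] its coefficient is zero. *)
case: b {H d0 d1} => [|c]; first by rewrite !expr0 /=; field.
rewrite /= !exprS; move: ((z / 2) ^+ c) => Z.
by field.
Qed.

Lemma bessel_J_sqrt (R : realType) (b : nat) (x : R) : 0 < x ->
  bessel_J b (Num.sqrt (4 * x)) = Num.sqrt (x ^+ b) * bessel_phi b x /\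
  Num.sqrt (4 * x) * derive1 (@bessel_J R b) (Num.sqrt (4 * x))
  = Num.sqrt (x ^+ b) * (b%:R * bessel_phi b x - 2 * x * bessel_phi b.+1 x).
Proof.
move=> x0.
have s4 : Num.sqrt (4 * x) = 2 * Num.sqrt x.
  rewrite sqrtrM//; congr (_ * _).
  by rewrite (_ : 4 = 2 ^+ 2 :> R) ?sqrtr_sqr ?ger0_norm// -natrX.
have z0 : 0 < Num.sqrt (4 * x) by rewrite sqrtr_gt0 mulr_gt0.
have h2 : Num.sqrt (4 * x) / 2 = Num.sqrt x by rewrite s4 mulrC mulKf.
have hb : Num.sqrt x ^+ b = Num.sqrt (x ^+ b).
  elim: b => [|c IH]; first by rewrite !expr0 sqrtr1.
  by rewrite !exprS sqrtrM ?IH// ltW.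
have hx : Num.sqrt x ^+ 2 = x by rewrite sqr_sqrtr// ltW.
split; first by rewrite bessel_JE h2 hx hb.
have [_ D] := is_derive_bessel_J b z0.
by rewrite derive1E D h2 hx hb mulrC divfK// gt_eqF.
Qed.

(** The terms with the factor [b] in [bessel_J_sqrt] cancel by antisymmetry; what remains is the
    Wronskian at [q = 1]. *)
Lemma bessel_kernel_off_diagE (R : realType) (b : nat) (x y : R) :
  0 < x -> 0 < y -> x != y ->
  bessel_kernel_off_diag b (4 * x) (4 * y)
  = 4^-1 * (Num.sqrt (x ^+ b) * Num.sqrt (y ^+ b) * bessel_primitive b x y 1).
Proof.
move=> x0 y0 xy; rewrite /bessel_kernel_off_diag.
have [ex dx] := bessel_J_sqrt b x0; have [ey dy] := bessel_J_sqrt b y0.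
rewrite -(mulrA (bessel_J b (Num.sqrt (4 * x)))) dy ex.
rewrite -(mulrA (bessel_J b (Num.sqrt (4 * y)))) dx ey.
rewrite /bessel_primitive expr1n !mul1r.
have xy0 : x - y != 0 by rewrite subr_eq0.
by field; rewrite xy0 /= -mulrBr mulf_neq0.
Qed.

(** * Grid estimates *)

Definition jacobi_grid (R : realType) (a : R) (n j : nat) : R :=
  j%:R * (j%:R + a) / jacobi_scale a n.

(** A source of uniformity in [a]: whatever is linear in [n + a] becomes [O(1/n)] after division by
    [n * (n + a)]. *)
Lemma div_jacobi_scale_le (R : realType) (a c d : R) (n : nat) :
  0 <= a -> (0 < n)%N -> c <= d * (n%:R + a) ->
  c / jacobi_scale a n <= d / n%:R.
Proof.
move=> a0 n0 h; rewrite ler_pdivrMr ?jacobi_scale_gt0// /jacobi_scale.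
by rewrite mulrA divfK// pnatr_eq0 -lt0n.
Qed.

Lemma jacobi_grid_itv (R : realType) (a : R) (n j : nat) :
  0 <= a -> (0 < n)%N -> (j <= n)%N -> 0 <= jacobi_grid a n j <= 1.
Proof.
move=> a0 n0 jn; have N0 := jacobi_scale_gt0 a0 n0; apply/andP; split.
  by rewrite divr_ge0 ?mulr_ge0 ?addr_ge0// ltW.
rewrite ler_pdivrMr// mul1r /jacobi_scale.
have jn' : j%:R <= n%:R :> R by rewrite ler_nat.
by rewrite ler_pM ?addr_ge0// lerD2r.
Qed.

(** Up to the summand [b], the numerator is the linear factor of [jacobi_sqnorm_inv]; this is why
    the kernel is a Riemann sum on this grid. *)
Lemma jacobi_gridS (R : realType) (a : R) (n j : nat) :
  jacobi_grid a n j.+1 - jacobi_grid a n j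
  = (2 * j%:R + 1 + a) / jacobi_scale a n.
Proof. by rewrite /jacobi_grid -mulrBl -natr1; congr (_ / _); ring. Qed.

Lemma jacobi_grid_step (R : realType) (a : R) (n j : nat) :
  0 <= a -> (j < n)%N ->
  0 < jacobi_grid a n j.+1 - jacobi_grid a n j <= 2 / n%:R.
Proof.
move=> a0 jn; have n0 : (0 < n)%N by apply: leq_ltn_trans jn.
rewrite jacobi_gridS; apply/andP; split.
  rewrite divr_gt0 ?jacobi_scale_gt0// -addrA ltr_wpDl ?mulr_ge0//.
  by rewrite ltr_wpDr.
apply: div_jacobi_scale_le => //.
have : j%:R + 1 <= n%:R :> R by rewrite natr1 ler_nat.
lra.
Qed.

(** One factor is replaced at a time. Each is at most [1 + L], and [(1 + L)^k * L + (1 + L)^k = (1 +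
    L)^(k+1)]. *)
Lemma prod_sub_expr_le (R : realType) (f : nat -> R) (q L e : R) (k : nat) :
  0 <= q <= 1 -> 0 <= L -> 0 <= e <= 1 ->
  (forall i, (i < k)%N -> `|f i - q| <= L * e) ->
  `|\prod_(i < k) f i - q ^+ k| <= (1 + L) ^+ k * e.
Proof.
move=> /andP[q0 q1] L0 /andP[e0 e1]; elim: k => [|k IH] hf.
  by rewrite big_ord0 expr0 subrr normr0 expr0 mul1r.
have fle i : (i < k.+1)%N -> `|f i| <= 1 + L.
  move=> /hf h; rewrite -(subrK q (f i)) (le_trans (ler_normD _ _))// addrC.
  by apply: lerD; [rewrite ger0_norm|rewrite (le_trans h)// ler_piMr].
have Pk : `|\prod_(i < k) f i| <= (1 + L) ^+ k.
  rewrite normr_prod -[k in leRHS]card_ord -prodr_const; apply: ler_prod => i _.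
  by rewrite normr_ge0 fle// ltnS ltnW.
rewrite big_ord_recr/= exprS exprS.
have -> : \prod_(i < k) f i * f k - q * q ^+ k
   = \prod_(i < k) f i * (f k - q) + (\prod_(i < k) f i - q ^+ k) * q by ring.
rewrite (le_trans (ler_normD _ _))// !normrM.
have h1 : `|\prod_(i < k) f i| * `|f k - q| <= (1 + L) ^+ k * (L * e).
  by apply: ler_pM => //; apply: hf.
have h2 : `|\prod_(i < k) f i - q ^+ k| * `|q| <= (1 + L) ^+ k * e.
  rewrite (ger0_norm q0) (le_trans (ler_piMr _ q1))// IH// => i ik.
  by apply: hf; rewrite ltnW.
rewrite (le_trans (lerD h1 h2))//.
by rewrite [leRHS](_ : _ = (1 + L) ^+ k * (L * e) + (1 + L) ^+ k * e)//; ring.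
Qed.

Lemma jacobi_sqnorm_inv_grid (R : realType) (a : R) (b n j : nat) :
  0 <= a -> (j < n)%N ->
  `| \prod_(i < b) ((j%:R + i.+1%:R) * (j%:R + a + i.+1%:R))
     / jacobi_scale a n ^+ b - jacobi_grid a n j ^+ b |
  <= (1 + b%:R * (b%:R + 2)) ^+ b / n%:R.
Proof.
move=> a0 jn; have n0 : (0 < n)%N by apply: leq_ltn_trans jn.
have N0 := @jacobi_scale_gt0 R a n a0 n0.
have -> : jacobi_scale a n ^+ b = \prod_(i < b) jacobi_scale a n.
  by rewrite prodr_const card_ord.
rewrite -prodf_div/=.
apply: (@prod_sub_expr_le R (fun i => (j%:R + i.+1%:R) * (j%:R + a + i.+1%:R)
   / jacobi_scale a n)).
- by apply: jacobi_grid_itv => //; apply: ltnW.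
- by rewrite mulr_ge0// addr_ge0.
- by rewrite invr_ge0 ler0n/= invf_le1 ?ltr0n// ler1n.
move=> i ib; rewrite /jacobi_grid -mulrBl.
have -> : (j%:R + i.+1%:R) * (j%:R + a + i.+1%:R) - j%:R * (j%:R + a)
  = i.+1%:R * (2 * j%:R + a + i.+1%:R) by ring.
rewrite ger0_norm; last by rewrite divr_ge0 ?mulr_ge0 ?addr_ge0 ?mulr_ge0 ?(ltW N0).
apply: div_jacobi_scale_le => //.
have h1 : j%:R <= n%:R :> R by rewrite ler_nat ltnW.
have h2 : i.+1%:R <= b%:R :> R by rewrite ler_nat.
have h3 : 1 <= n%:R :> R by rewrite ler1n.
rewrite -mulrA; apply: ler_pM => //; first by rewrite !addr_ge0 ?mulr_ge0.
have h4 : 0 <= b%:R * (n%:R + a - 1) by rewrite mulr_ge0//; lra.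
by rewrite mulrDl; lra.
Qed.

Lemma sqr_le_exp4 (R : realType) (m : nat) : m.+1%:R ^+ 2 <= 4 ^+ m :> R.
Proof.
elim: m => [|m IH]; first by rewrite expr1n expr0.
have h : m.+2%:R <= 2 * m.+1%:R :> R.
  by rewrite -natrM ler_nat mul2n -addnn addSn ltnS leq_addl.
rewrite [4 ^+ _]exprS (le_trans _ (ler_wpM2l _ IH))//.
rewrite (_ : 4 * _ = (2 * m.+1%:R) ^+ 2); last by ring.
by rewrite ler_pXn2r ?nnegrE ?mulr_ge0.
Qed.

(** The [k]-th factor is within [B * (k + 1)^2 / n] of [q], which is not uniform in [k]. By
    [sqr_le_exp4] the error grows only geometrically in [m], and the factorials in [bessel_coef]
    will absorb it. *)
Lemma jacobi_fact_grid (R : realType) (a : R) (b n j m : nat) :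
  0 <= a -> (j < n)%N ->
  `| jacobi_fact a b j m / jacobi_scale a n ^+ m - jacobi_grid a n j ^+ m |
  <= (4 * (b%:R + 2)) ^+ m / n%:R.
Proof.
move=> a0 jn; have n0 : (0 < n)%N by apply: leq_ltn_trans jn.
have N0 := @jacobi_scale_gt0 R a n a0 n0; set N := jacobi_scale a n in N0 *.
have /andP[q0 q1] := @jacobi_grid_itv R a n j a0 n0 (ltnW jn).
set q := jacobi_grid a n j in q0 q1 *; set B : R := b%:R + 2.
have n1 : 1 <= n%:R :> R by rewrite ler1n.
have jn' : j%:R <= n%:R :> R by rewrite ler_nat ltnW.
pose d k := jacobi_fact a b j k / N ^+ k.
pose rho (k : nat) := (j%:R - k%:R) * (j%:R + k%:R + a + b%:R + 1) / N.
have dS k : d k.+1 = d k * rho k.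
  by rewrite /d /rho jacobi_factS exprSr invfM; ring.
have rho_q k : `|rho k - q| <= B * k.+1%:R ^+ 2 / n%:R.
  rewrite /rho /q /jacobi_grid -/N -mulrBl normrM.
  rewrite [`|N^-1|]ger0_norm ?invr_ge0 ?(ltW N0)//.
  apply: div_jacobi_scale_le => //.
  have -> : (j%:R - k%:R) * (j%:R + k%:R + a + b%:R + 1) - j%:R * (j%:R + a)
    = j%:R * (b%:R + 1) - k%:R * (k%:R + b%:R + 1 + a) by ring.
  rewrite (le_trans (ler_normB _ _))// !ger0_norm ?mulr_ge0 ?addr_ge0//.
  have k0 : 0 <= k%:R :> R by []. have b0 : 0 <= b%:R :> R by [].
  rewrite /B -natr1; set kr : R := k%:R in k0 *; set br : R := b%:R in b0 *.
  set s := n%:R + a; have s1 : 1 <= s by rewrite ler_wpDr.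
  have e1 : j%:R * (br + 1) <= s * (br + 1) by apply: ler_wpM2r; rewrite /s; lra.
  have e2 : 1 * (kr * (kr + br + 1)) <= s * (kr * (kr + br + 1)).
    by apply: ler_wpM2r => //; rewrite mulr_ge0// !addr_ge0.
  have e3 : a * kr <= s * kr by apply: ler_wpM2r => //; rewrite /s; lra.
  have e4 : 0 <= s * ((br + 1) * kr ^+ 2 + (br + 2) * kr + 1).
    by rewrite mulr_ge0 ?addr_ge0 ?mulr_ge0 ?exprn_ge0 ?addr_ge0//; lra.
  rewrite [leRHS](_ : _ = s * (br + 1) + s * (kr * (kr + br + 1)) + s * kr
    + s * ((br + 1) * kr ^+ 2 + (br + 2) * kr + 1)); last by ring.
  lra.
have B2 : 2 <= B by rewrite lerDr.
(* Beyond [k = j] the product vanishes; up to there each factor lies in [[0, B]], since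
   [j + a + b + 1 <= B * (n + a)]. *)
have dB k : 0 <= d k <= B ^+ k.
  elim: k => [|k IH]; first by rewrite /d /jacobi_fact big_ord0 !expr0 divr1 ler01 lexx.
  rewrite dS exprSr; have [kj|jk] := leqP k j; last first.
    rewrite /d jacobi_fact_eq0// !mul0r lexx/= mulr_ge0 ?exprn_ge0//; lra.
  have kj' : k%:R <= j%:R :> R by rewrite ler_nat.
  have b0 : 0 <= b%:R :> R by [].
  have k0 : 0 <= k%:R :> R by [].
  have /andP[d0 d1] := IH; have r0 : 0 <= rho k.
    by rewrite /rho divr_ge0 ?mulr_ge0 ?(ltW N0) ?subr_ge0 ?addr_ge0.
  rewrite mulr_ge0//= ler_pM// /rho ler_pdivrMr// /B /N /jacobi_scale.
  have e1 : (j%:R - k%:R) * (j%:R + k%:R + a + b%:R + 1)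
    <= j%:R * (j%:R + a + b%:R + 1) :> R.
    have : 0 <= k%:R * (k%:R + a + b%:R + 1) :> R by rewrite mulr_ge0 ?addr_ge0.
    lra.
  rewrite (le_trans e1)// mulrCA ler_pM ?addr_ge0//.
  have : 0 <= (b%:R + 1) * (n%:R + a - 1) :> R.
    by apply: mulr_ge0; lra.
  lra.
elim: m => [|m IH].
  by rewrite /jacobi_fact big_ord0 !expr0 divr1 subrr normr0 mul1r invr_ge0.
rewrite -/(d m.+1) dS [q ^+ _]exprS.
have -> : d m * rho m - q * q ^+ m = d m * (rho m - q) + (d m - q ^+ m) * q by ring.
rewrite (le_trans (ler_normD _ _))// [`|d m * _|]normrM [`|_ * q|]normrM.
have /andP[d0 d1] := dB m.
have h1 : `|d m| * `|rho m - q| <= B ^+ m * (B * 4 ^+ m / n%:R).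
  rewrite (ger0_norm d0); apply: ler_pM => //; rewrite (le_trans (rho_q m))//.
  by rewrite ler_wpM2r// ler_wpM2l ?sqr_le_exp4//; lra.
have h2 : `|d m - q ^+ m| * `|q| <= (4 * B) ^+ m / n%:R.
  by rewrite (ger0_norm q0) (le_trans (ler_piMr _ q1)).
(* The induction closes because [B + 1 <= 4 * B]. *)
rewrite (le_trans (lerD h1 h2))// exprMn exprS exprMn.
set X := 4 ^+ m; set Y := B ^+ m; set i := n%:R^-1.
have XY : 0 <= X * Y * i.
  by rewrite !mulr_ge0 ?exprn_ge0 ?invr_ge0//; lra.
have : 0 <= (3 * B - 1) * (X * Y * i) by rewrite mulr_ge0//; lra.
lra.
Qed.

(** The [m]-th terms differ by at most [(c * M)^m / (m! * n)] with [c = 4 * (b + 2)], and these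
    bounds sum to the exponential. *)
Lemma jacobi_poly_grid (R : realType) (a M x : R) (b n j : nat) :
  0 <= a -> (j < n)%N -> 0 <= x <= M ->
  `| (jacobi_poly a b j).[x / jacobi_scale a n]
     - bessel_phi b (jacobi_grid a n j * x) |
  <= expR (4 * (b%:R + 2) * M) / n%:R.
Proof.
move=> a0 jn /andP[x0 xM]; have n0 : (0 < n)%N by apply: leq_ltn_trans jn.
set N := jacobi_scale a n; set q := jacobi_grid a n j.
set c := 4 * (b%:R + 2); have c0 : 0 <= c :> R by rewrite mulr_ge0 ?addr_ge0.
pose u k := \sum_(0 <= m < k) bessel_coef R b m * (q * x) ^+ m.
have H : `|(jacobi_poly a b j).[x / N] - u k| @[k --> \oo] -->
    `|(jacobi_poly a b j).[x / N] - bessel_phi b (q * x)|.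
  by apply: cvg_norm; apply: cvgB; [exact: cvg_cst|exact: bessel_phi_cvg].
apply: (cvgr_to_le H); near=> k.
(* A partial sum this long covers the whole polynomial, padded with zero coefficients that obey the
   same estimate. *)
have jk : (j < k)%N by near: k; exists j.+1.
rewrite (@horner_coef_wide _ k); last by rewrite (leq_trans (size_poly _ _)).
rewrite /u big_mkord -sumrB (le_trans (ler_norm_sum _ _ _))//.
rewrite (@le_trans _ _ (\sum_(m < k) (c * M) ^+ m / m`!%:R / n%:R))//; last first.
  rewrite -mulr_suml ler_wpM2r ?invr_ge0//.
  rewrite -(big_mkord xpredT (fun m => (c * M) ^+ m / m`!%:R)).
  by apply: sum_exp_le; rewrite mulr_ge0// (le_trans x0).
apply: ler_sum => m _; rewrite coef_jacobi_poly.
have -> : bessel_coef R b m * jacobi_fact a b j m * (x / N) ^+ m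
   - bessel_coef R b m * (q * x) ^+ m =
   bessel_coef R b m * (jacobi_fact a b j m / N ^+ m - q ^+ m) * x ^+ m.
  rewrite (exprMn _ q x) (exprMn _ x N^-1) exprVn.
  by move: (N ^+ m)^-1 (q ^+ m) (x ^+ m) => A B C; ring.
rewrite [`|_ * x ^+ m|]normrM [`|bessel_coef R b m * _|]normrM.
rewrite [`|x ^+ m|]ger0_norm ?exprn_ge0//.
have -> : (c * M) ^+ m / m`!%:R / n%:R = m`!%:R^-1 * (c ^+ m / n%:R) * M ^+ m.
  by rewrite (exprMn _ c M); move: (c ^+ m) (M ^+ m) => A B; ring.
apply: ler_pM; rewrite ?mulr_ge0 ?exprn_ge0//; last first.
  by rewrite lerXn2r// nnegrE// (le_trans x0).
by apply: ler_pM => //; [exact: bessel_coef_le|exact: jacobi_fact_grid].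
Unshelve. all: by end_near. Qed.

(** * Comparison of the Riemann sum with the primitive *)

Lemma lipschitz_is_derive (R : realType) (f df : R -> R) (K s t : R) :
  (forall z : R, is_derive z 1 f (df z)) ->
  (forall z : R, 0 <= z <= 1 -> `|df z| <= K) ->
  0 <= s <= 1 -> 0 <= t <= 1 -> `|f s - f t| <= K * `|s - t|.
Proof.
move=> fdf dfK; wlog st : s t / s <= t => [wl|] hs ht.
  by case: (leP s t) => [/wl|/ltW/wl]; last rewrite distrC [`|s - t|]distrC; apply.
have [|c] := MVT_segment st (fun z _ => fdf z).
  by apply: derivable_within_continuous => z _; case: (fdf z).
rewrite in_itv/= => /andP[sc ct]; rewrite distrC => ->.
rewrite normrM distrC ler_wpM2r// dfK//.
have /andP[s0 _] := hs; have /andP[_ t1] := ht.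
by rewrite (le_trans s0)//= (le_trans ct).
Qed.

Lemma bessel_phi_scale_le (R : realType) (b : nat) (M x q : R) :
  0 <= x <= M -> 0 <= q <= 1 -> `|bessel_phi b (q * x)| <= expR M.
Proof.
move=> /andP[x0 xM] /andP[q0 q1]; rewrite (le_trans (bessel_phi_le _ _))//.
rewrite ler_expR ger0_norm ?mulr_ge0//.
by rewrite (le_trans (ler_piMl x0 q1)).
Qed.

Lemma bessel_phi_lipschitz (R : realType) (b : nat) (M x s t : R) :
  0 <= x <= M -> 0 <= s <= 1 -> 0 <= t <= 1 ->
  `|bessel_phi b (s * x) - bessel_phi b (t * x)| <= M * expR M * `|s - t|.
Proof.
move=> hx; apply: (@lipschitz_is_derive R (fun q => bessel_phi b (q * x))
  (fun q => - x * bessel_phi b.+1 (q * x))).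
  by move=> z; apply: is_derive_bessel_phi_scale.
move=> z hz; rewrite normrM; have /andP[x0 xM] := hx.
by apply: ler_pM => //; [rewrite normrN ger0_norm|exact: bessel_phi_scale_le hx hz].
Qed.

Lemma expr_lipschitz (R : realType) (b : nat) (s t : R) :
  0 <= s <= 1 -> 0 <= t <= 1 -> `|s ^+ b - t ^+ b| <= b%:R * `|s - t|.
Proof.
apply: (@lipschitz_is_derive _ (fun z => z ^+ b) (fun z => b%:R * z ^+ b.-1)).
  move=> z; have := is_deriveX b (is_derive_id z (1 : R)); rewrite exprfctE => H.
  by apply: (is_derive_eq H); exact: mulr1.
move=> z /andP[z0 z1]; rewrite ger0_norm ?mulr_ge0 ?exprn_ge0//.
by rewrite ler_piMr// exprn_ile1.
Qed.

Lemma prod3_dist_le (R : realType) (K e u v w u' v' w' : R) :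
  0 <= e -> `|u| <= K -> `|v| <= K -> `|v'| <= K -> `|w'| <= K ->
  `|u' | <= K -> `|w| <= K ->
  `|u - u'| <= K * e -> `|v - v'| <= K * e -> `|w - w'| <= K * e ->
  `|u * (v * w) - u' * (v' * w')| <= 3 * K ^+ 3 * e.
Proof.
move=> e0 hu hv hv' hw' hu' hw du dv dw.
have K0 : 0 <= K by rewrite (le_trans _ hu).
have -> : u * (v * w) - u' * (v' * w')
  = (u - u') * (v * w) + (u' * ((v - v') * w) + u' * (v' * (w - w'))) by ring.
have e1 : `|(u - u') * (v * w)| <= K * e * (K * K).
  by rewrite !normrM; do ?apply: ler_pM => //; rewrite mulr_ge0.
have e2 : `|u' * ((v - v') * w)| <= K * (K * e * K).
  by rewrite !normrM; do ?apply: ler_pM => //; rewrite mulr_ge0.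
have e3 : `|u' * (v' * (w - w'))| <= K * (K * (K * e)).
  by rewrite !normrM; do ?apply: ler_pM => //; rewrite mulr_ge0.
have := ler_normD ((u - u') * (v * w)) (u' * ((v - v') * w) + u' * (v' * (w - w'))).
have := ler_normD (u' * ((v - v') * w)) (u' * (v' * (w - w'))).
have -> : 3 * K ^+ 3 * e = K * e * (K * K) + (K * (K * e * K) + K * (K * (K * e))).
  by ring.
lra.
Qed.

(** The mean value theorem turns the increment over a grid cell into an exact Riemann term, so no
    integral has to be formed. *)
Lemma bessel_primitive_step (R : realType) (b : nat) (x y s t : R) :
  x != y -> s <= t ->
  exists2 c, s <= c <= t &
    bessel_primitive b x y t - bessel_primitive b x y s
    = (t - s) * (c ^+ b * (bessel_phi b (c * x) * bessel_phi b (c * y))).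
Proof.
move=> xy st; have D z := is_derive_bessel_primitive b z xy.
have [|c] := MVT_segment st (fun z _ => D z).
  by apply: derivable_within_continuous => z _; case: (D z).
by rewrite in_itv/= => cst ->; exists c => //; rewrite mulrC.
Qed.

(** The comparison goes cell by cell: each of the [n] cells contributes an error [O(1/n^2)],
    uniformly in [a], [x] and [y]. *)
Lemma jacobi_sum_approx (R : realType) (b : nat) (M : R) : 0 <= M ->
  exists2 K : R, 0 <= K & forall (a : R) (n : nat) (x y : R),
    0 <= a -> (0 < n)%N -> 0 <= x <= M -> 0 <= y <= M -> x != y ->
    `|jacobi_sum a b n x y - bessel_primitive b x y 1| <= K / n%:R
    /\ `|bessel_primitive b x y 1| <= K.
Proof.
move=> M0; set e : R := expR M; have e0 : 0 < e := expR_gt0 M.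
pose w : R := (1 + b%:R * (b%:R + 2)) ^+ b.
pose r : R := expR (4 * (b%:R + 2) * M).
have b0 : 0 <= b%:R :> R by [].
have w0 : 0 <= w by rewrite exprn_ge0// addr_ge0// mulr_ge0// addr_ge0.
have r0 : 0 < r := expR_gt0 _.
have Me0 : 0 <= M * e by rewrite mulr_ge0// ltW.
(* [K] majorizes every factor of a Riemann term and every coefficient of [1/n] in their errors. *)
pose K := 1 + e + w + r + 2 * b%:R + 2 * (M * e).
have K0 : 0 <= K by rewrite /K; lra.
(* Here [b] stems from the surplus [b / N] in the cell length, [6 = 2 * 3] from the mesh [2 / n]
   times the bound of [prod3_dist_le], and [e * e] bounds the primitive at 1. *)
exists ((b%:R + 6) * K ^+ 3 + e * e).
  apply: addr_ge0; last by rewrite mulr_ge0// ltW.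
  by apply: mulr_ge0; [rewrite addr_ge0|exact: exprn_ge0].
move=> a n x y a0 n0 hx hy xy.
have n1 : 1 <= n%:R :> R by rewrite ler1n.
have ni0 : 0 <= n%:R^-1 :> R by rewrite invr_ge0.
have ni1 : n%:R^-1 <= 1 :> R by rewrite invf_le1// (lt_le_trans ltr01).
have prim0 : bessel_primitive b x y 0 = 0.
  by rewrite /bessel_primitive expr0n/= !mul0r.
split; last first.
  have [c hc] := @bessel_primitive_step R b x y 0 1 xy ler01.
  rewrite prim0 !subr0 mul1r => ->.
  have /andP[c0 c1] := hc.
  rewrite !normrM; have h : `|c ^+ b| <= 1.
    by rewrite ger0_norm ?exprn_ge0// exprn_ile1.
  rewrite (le_trans (ler_piMl _ h)) ?mulr_ge0//.
  have h1 : `|bessel_phi b (c * x)| * `|bessel_phi b (c * y)| <= e * e.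
    by apply: ler_pM => //; apply: bessel_phi_scale_le.
  by rewrite (le_trans h1)// lerDr mulr_ge0 ?exprn_ge0// addr_ge0.
pose q := jacobi_grid a n; set N := jacobi_scale a n.
have N0 : 0 < N by apply: jacobi_scale_gt0.
(* The sum telescopes, as the grid runs from 0 to 1 and the primitive vanishes at 0. *)
have prim1 : bessel_primitive b x y 1 = \sum_(j < n)
    (bessel_primitive b x y (q j.+1) - bessel_primitive b x y (q j)).
  rewrite -(big_mkord xpredT (fun j => bessel_primitive b x y (q j.+1)
     - bessel_primitive b x y (q j))) telescope_sumr//.
  rewrite /q /jacobi_grid !mul0r prim0 subr0; congr bessel_primitive.
  by rewrite -/(jacobi_scale a n) divff// gt_eqF.
rewrite prim1 /jacobi_sum -sumrB (le_trans (ler_norm_sum _ _ _))//.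
rewrite (@le_trans _ _
  (\sum_(j < n) ((b%:R + 6) * K ^+ 3 / n%:R / n%:R)))//; last first.
  rewrite sumr_const card_ord -[_ *+ n]mulr_natl mulrC divfK ?gt_eqF ?ltr0n//.
  by rewrite ler_wpM2r// lerDl mulr_ge0// ltW.
apply: ler_sum => j _; have jn := ltn_ord j.
have /andP[D0 D2] := @jacobi_grid_step R a n j a0 jn; rewrite -/q in D0 D2.
have qj := @jacobi_grid_itv R a n j a0 n0 (ltnW jn); rewrite -/q in qj.
have qj1 := @jacobi_grid_itv R a n j.+1 a0 n0 jn; rewrite -/q in qj1.
have [|c /andP[c1 c2] ->] := @bessel_primitive_step R b x y (q j) (q j.+1) xy.
  by rewrite -subr_ge0 ltW.
have hc : 0 <= c <= 1.
  by have /andP[h1 _] := qj; have /andP[_ h2] := qj1; apply/andP; split; lra.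
have dc : `|q j - c| <= 2 / n%:R by rewrite ler0_norm; lra.
set D := q j.+1 - q j in D0 D2 *.
set W := \prod_(i < b) ((j%:R + i.+1%:R) * (j%:R + a + i.+1%:R)) / N ^+ b : R.
set P := (jacobi_poly a b j).[x / N]; set Q := (jacobi_poly a b j).[y / N].
have -> : jacobi_sqnorm_inv a b j / N ^+ b.+1 * (P * Q)
   = (D + b%:R / N) * (W * (P * Q)).
  rewrite /D /q jacobi_gridS -/N -mulrDl /W /jacobi_sqnorm_inv exprS invfM.
  by move: (\prod_(i < b) _) (N ^+ b)^-1 => U V; ring.
(* Two errors add up: from the polynomial to [bessel_phi] at the grid point, then from the grid
   point to [c]. *)
have phi_close z (hz : 0 <= z <= M) :
    `|(jacobi_poly a b j).[z / N] - bessel_phi b (c * z)|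
    <= (r + 2 * (M * e)) / n%:R.
  have h1 := @jacobi_poly_grid R a M z b n j a0 jn hz.
  have h2 := bessel_phi_lipschitz b hz qj hc.
  have h3 : M * e * `|q j - c| <= M * e * (2 / n%:R) by apply: ler_wpM2l.
  rewrite -(subrKA (bessel_phi b (q j * z))) (le_trans (ler_normD _ _))//.
  rewrite [leRHS](_ : _ = r / n%:R + M * e * (2 / n%:R)); last by ring.
  by apply: lerD => //; rewrite (le_trans h2).
have phi_le z (hz : 0 <= z <= M) : `|bessel_phi b (c * z)| <= e.
  exact: bessel_phi_scale_le.
have poly_le z (hz : 0 <= z <= M) : `|(jacobi_poly a b j).[z / N]| <= K.
  have h1 := phi_close z hz; have h2 := phi_le z hz.
  rewrite -(subrK (bessel_phi b (c * z)) _.[_]) (le_trans (ler_normD _ _))//.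
  have h3 : (r + 2 * (M * e)) / n%:R <= r + 2 * (M * e).
    by rewrite ler_piMr//; lra.
  rewrite /K; lra.
have W_close : `|W - c ^+ b| <= (w + 2 * b%:R) / n%:R.
  have h1 := @jacobi_sqnorm_inv_grid R a b n j a0 jn.
  have h2 := expr_lipschitz b qj hc.
  have h3 : b%:R * `|q j - c| <= b%:R * (2 / n%:R) by apply: ler_wpM2l.
  rewrite -(subrKA (q j ^+ b)) (le_trans (ler_normD _ _))//.
  rewrite [leRHS](_ : _ = w / n%:R + b%:R * (2 / n%:R)); last by ring.
  by apply: lerD => //; rewrite (le_trans h2).
have cb : `|c ^+ b| <= 1.
  by have /andP[? ?] := hc; rewrite ger0_norm ?exprn_ge0// exprn_ile1.
have W_le : `|W| <= K.
  rewrite -(subrK (c ^+ b) W) (le_trans (ler_normD _ _))//.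
  have h3 : (w + 2 * b%:R) / n%:R <= w + 2 * b%:R by rewrite ler_piMr//; lra.
  rewrite /K; lra.
have h3 : `|W * (P * Q) - c ^+ b * (bessel_phi b (c * x) * bessel_phi b (c * y))|
    <= 3 * K ^+ 3 * n%:R^-1.
  apply: prod3_dist_le => //; try exact: poly_le.
  - by rewrite (le_trans (phi_le _ hx))// /K; lra.
  - by rewrite (le_trans (phi_le _ hy))// /K; lra.
  - by rewrite (le_trans cb)// /K; lra.
  - by rewrite (le_trans W_close)// ler_wpM2r// /K; lra.
  - by rewrite (le_trans (phi_close _ hx))// ler_wpM2r// /K; lra.
  - by rewrite (le_trans (phi_close _ hy))// ler_wpM2r// /K; lra.
set Z := c ^+ b * _ in h3 *.
have -> : (D + b%:R / N) * (W * (P * Q)) - D * Z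
  = b%:R / N * (W * (P * Q)) + D * (W * (P * Q) - Z) by ring.
(* Since [N >= n^2], the surplus remains [O(1/n)] after summation over [n] cells. *)
have bN : b%:R / N <= b%:R / n%:R / n%:R.
  rewrite -mulrA ler_wpM2l// -invfM lef_pV2 ?posrE ?mulr_gt0 ?ltr0n//.
    by rewrite /N /jacobi_scale ler_wpM2l// lerDl.
  by rewrite ltr_wpDr ?ltr0n.
have h4 : `|b%:R / N * (W * (P * Q))| <= b%:R / n%:R / n%:R * K ^+ 3.
  rewrite normrM ger0_norm; last by rewrite divr_ge0// ltW.
  apply: ler_pM => //; first by rewrite divr_ge0// ltW.
  rewrite [K ^+ 3]exprS [K ^+ 2]expr2 (normrM W) (normrM P).
  by do ?apply: ler_pM => //; exact: poly_le.
have h5 : `|D * (W * (P * Q) - Z)| <= 2 / n%:R * (3 * K ^+ 3 * n%:R^-1).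
  by rewrite normrM (ger0_norm (ltW D0)); apply: ler_pM => //; rewrite ltW.
rewrite (le_trans (ler_normD _ _))// (le_trans (lerD h4 h5))//.
rewrite [leLHS](_ : _ = (b%:R + 6) * K ^+ 3 / n%:R / n%:R)//; ring.
Qed.

(** * Uniform estimate and passage to the limit *)

(** A Bernoulli inequality that also covers [a < 1]: [exp z >= 1 + z] at [z = a * ln (1 - h)], with
    [- ln (1 - h) <= h / (1 - h) <= 2 * h]. *)
Lemma powR_sub1_ge (R : realType) (a h : R) : 0 <= a -> 0 <= h <= 2^-1 ->
  1 - 2 * a * h <= (1 - h) `^ a.
Proof.
move=> a0 /andP[h0 h2]; have h1 : 0 < 1 - h by lra.
rewrite /powR gt_eqF//; apply: le_trans (expR_ge1Dx _).
rewrite -[1 - h]invrK lnV ?posrE ?invr_gt0//.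
have -> : (1 - h)^-1 = 1 + h / (1 - h) by field; rewrite gt_eqF.
have h3 : h / (1 - h) <= 2 * h.
  by rewrite ler_pdivrMr//; nra.
have h4 : ln (1 + h / (1 - h)) <= h / (1 - h).
  by apply: le_ln1Dx; rewrite (lt_le_trans (ltrN10 R))// divr_ge0// ltW.
have : a * ln (1 + h / (1 - h)) <= a * (2 * h).
  by rewrite ler_wpM2l// (le_trans h4).
lra.
Qed.

Lemma edge_factor_close (R : realType) (a M x : R) (b n : nat) :
  0 <= a -> (0 < n)%N -> 0 <= x <= M -> 2 * M <= n%:R ->
  exists2 d, 1 - 2 * M / n%:R <= d <= 1 &
    edge_factor a b n x = d * Num.sqrt (x ^+ b) /\ 0 <= d.
Proof.
move=> a0 n0 /andP[x0 xM] Mn; have N0 := @jacobi_scale_gt0 R a n a0 n0.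
exists (Num.sqrt ((1 - x / jacobi_scale a n) `^ a)); last by rewrite sqrtr_ge0.
have n1 : 1 <= n%:R :> R by rewrite ler1n.
have np : 0 < n%:R :> R by rewrite ltr0n.
set h := x / jacobi_scale a n; have h0 : 0 <= h by rewrite divr_ge0// ltW.
have hM : h <= M / n%:R.
  apply: div_jacobi_scale_le => //; rewrite (le_trans xM)// ler_peMr ?(le_trans x0)//.
  by rewrite ler_wpDr.
have ahM : a * h <= M / n%:R.
  rewrite /h mulrA; apply: div_jacobi_scale_le => //; rewrite mulrC.
  by apply: ler_pM => //; rewrite lerDr.
have h2 : h <= 2^-1.
  by rewrite (le_trans hM)// ler_pdivrMr//; lra.
have p1 : (1 - h) `^ a <= 1.
  rewrite -[leRHS](_ : 1 `^ a = 1); last by rewrite powR1.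
  by rewrite ge0_ler_powR// ?nnegrE; lra.
have p0 := @powR_sub1_ge R a h a0.
have {p0} p0 : 1 - 2 * a * h <= (1 - h) `^ a by apply: p0; rewrite h0.
have s0 := sqrtr_ge0 ((1 - h) `^ a).
have s2 := sqr_sqrtr (powR_ge0 (1 - h) a).
have s1 : Num.sqrt ((1 - h) `^ a) <= 1.
  by rewrite -[leRHS]sqrtr1 ler_sqrt.
(* On [[0, 1]] the square root dominates its argument. *)
rewrite s1 andbT; apply: le_trans (_ : (1 - h) `^ a <= _).
  apply: le_trans p0; lra.
by rewrite -[leLHS]s2 expr2 ler_piMr.
Qed.

(** Two errors are combined: that of [jacobi_sum_approx], and the deviation of the edge factors from
    their limits, which multiplies the bounded primitive. *)
Lemma rescaled_kernel_off_diag (R : realType) (b : nat) (M : R) : 0 <= M ->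
  exists2 C : R, 0 <= C & forall (a : R) (n : nat) (p : nat -> {poly R}) (x y : R),
    0 <= a -> (0 < n)%N -> 2 * M <= n%:R -> orthonormal_jacobi a b%:R p ->
    0 < x <= M -> 0 < y <= M -> x != y ->
    `|rescaled_jacobi_kernel a b%:R p n (4 * x) (4 * y)
      - bessel_kernel_off_diag b (4 * x) (4 * y)| <= C / n%:R.
Proof.
move=> M0; have [K K0 HK] := @jacobi_sum_approx R b M M0.
pose s := Num.sqrt (M ^+ b); have s0 : 0 <= s := sqrtr_ge0 _.
exists (s * s * (K + 4 * M * K)); first by rewrite !(mulr_ge0, addr_ge0).
move=> a n p x y a0 n0 Mn op /andP[x0 xM] /andP[y0 yM] xy.
have hx : 0 <= x <= M by rewrite (ltW x0).
have hy : 0 <= y <= M by rewrite (ltW y0).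
have n1 : 1 <= n%:R :> R by rewrite ler1n.
have MN : M <= jacobi_scale a n.
  have h : n%:R * 1 <= n%:R * (n%:R + a) by rewrite ler_wpM2l// ler_wpDr.
  by rewrite /jacobi_scale; lra.
rewrite rescaled_jacobi_kernelE//; try by rewrite ltW//= (le_trans _ MN).
rewrite bessel_kernel_off_diagE//.
have [e1 /andP[e1l e1u] [-> e10]] := @edge_factor_close R a M x b n a0 n0 hx Mn.
have [e2 /andP[e2l e2u] [-> e20]] := @edge_factor_close R a M y b n a0 n0 hy Mn.
have [] := HK a n x y a0 n0 hx hy xy.
set J := jacobi_sum a b n x y; set H := bessel_primitive b x y 1 => h1 h2.
set sx := Num.sqrt (x ^+ b); set sy := Num.sqrt (y ^+ b).
have sxs : sx <= s.
  by rewrite ler_sqrt ?exprn_ge0// lerXn2r// nnegrE ltW.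
have sys : sy <= s.
  by rewrite ler_sqrt ?exprn_ge0// lerXn2r// nnegrE ltW.
have -> : 4^-1 * (e1 * sx * (e2 * sy) * J) - 4^-1 * (sx * sy * H)
  = 4^-1 * (sx * sy * (e1 * e2 * (J - H) - (1 - e1 * e2) * H)) by ring.
have sx0 : 0 <= sx := sqrtr_ge0 _. have sy0 : 0 <= sy := sqrtr_ge0 _.
have e12 : 0 <= e1 * e2 <= 1 by rewrite mulr_ge0//= mulr_ile1.
have e12' : 1 - e1 * e2 <= 4 * M / n%:R.
  have : 0 <= (1 - e1) * (1 - e2) by rewrite mulr_ge0// subr_ge0.
  lra.
have /andP[e12l e12u] := e12.
have g1 : `|e1 * e2 * (J - H)| <= K / n%:R.
  by rewrite normrM ger0_norm// (le_trans _ h1)// ler_piMl.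
have g2 : `|(1 - e1 * e2) * H| <= 4 * M / n%:R * K.
  by rewrite normrM ger0_norm ?subr_ge0//; apply: ler_pM => //; rewrite subr_ge0.
have g3 : `|e1 * e2 * (J - H) - (1 - e1 * e2) * H| <= K / n%:R + 4 * M / n%:R * K.
  by rewrite (le_trans (ler_normB _ _))// lerD.
rewrite normrM ger0_norm// normrM [`|sx * sy|]ger0_norm ?mulr_ge0//.
have g4 : sx * sy <= s * s by apply: ler_pM.
have g5 : sx * sy * `|e1 * e2 * (J - H) - (1 - e1 * e2) * H|
   <= s * s * (K / n%:R + 4 * M / n%:R * K).
  by apply: ler_pM => //; rewrite mulr_ge0.
have g6 := normr_ge0 (e1 * e2 * (J - H) - (1 - e1 * e2) * H).
have g7 := mulr_ge0 (mulr_ge0 sx0 sy0) g6.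
rewrite [leRHS](_ : _ = s * s * (K / n%:R + 4 * M / n%:R * K)); last by ring.
lra.
Qed.

(** The uniform approximation makes [f] Cauchy along [F], so [lim] is a genuine limit, and the bound
    passes to it. *)
Lemma uniform_approx_lim (R : realType) (T : Type) (F : set_system T)
    (g : nat -> T -> R) (l : nat -> R) (f : T -> R) (C : R) (n0 : nat) :
  ProperFilter F -> 0 <= C ->
  (forall n, (n0 <= n)%N -> g n @ F --> l n) ->
  (forall n, (n0 <= n)%N -> \forall t \near F, `|g n t - f t| <= C / n%:R) ->
  forall n, (n0 <= n)%N -> `|l n - lim (f @ F)| <= C / n%:R.
Proof.
move=> PF C0 gl gf n n0n.
have cf : cvg (f @ F).
  apply/cauchy_cvgP; apply: cauchy_exP => e e0.
  (* The limit [l k] will centre the ball of radius [e]: half for [g k] against [l k], half for [f]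
     against [g k]. *)
  have [k /andP[n0k ke]] : exists k, (n0 <= k)%N && (C / k%:R < e / 2).
    exists (maxn n0 (Num.truncn (C / (e / 2))).+1); rewrite leq_maxl/=.
    have e20 : 0 < e / 2 by rewrite divr_gt0.
    rewrite ltr_pdivrMr ?ltr0n ?leq_max ?orbT// mulrC -ltr_pdivrMr//.
    rewrite (lt_le_trans (truncnS_gt _))// ler_nat leq_maxr.
    by [].
  exists (l k); have /cvgrPdist_lt/(_ _ (divr_gt0 e0 (ltr0n _ 2))) h := gl k n0k.
  rewrite -[_ (ball _ _)]/(\forall t \near F, `|l k - f t| < e).
  near=> t; rewrite -(subrKA (g k t)) (le_lt_trans (ler_normD _ _))//.
  rewrite (splitr e) ltrD//; first by near: t; exact: h.
  rewrite (le_lt_trans _ ke)//; near: t; exact: gf.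
have H : `|g n t - f t| @[t --> F] --> `|l n - lim (f @ F)|.
  by apply: cvg_norm; apply: cvgB; [exact: gl|exact: cf].
by apply: (cvgr_to_le H); exact: gf.
Unshelve. all: by end_near. Qed.

(** * Continuity of the scaled kernels and extension to the closed quadrant *)

Lemma edge_factor_continuous (R : realType) (a : R) (b n : nat) (x : R) :
  0 <= a -> (0 < n)%N -> x < jacobi_scale a n ->
  {for x, continuous (edge_factor a b n)}.
Proof.
move=> a0 n0 xN; have N0 := @jacobi_scale_gt0 R a n a0 n0.
set N := jacobi_scale a n in xN N0.
apply: cvgM.
  apply: (@continuous_comp R R R (fun y => (1 - y / N) `^ a) Num.sqrt);
    last exact: sqrt_continuous.
  apply: (@continuous_comp R R R (fun y => y / N) (fun y => (1 - y) `^ a)).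
    by apply: cvgM; [exact: cvg_id|exact: cvg_cst].
  by apply: powR_sub1_continuous; rewrite ltr_pdivrMr// mul1r.
apply: (@continuous_comp R R R (fun y => y ^+ b) Num.sqrt);
  last exact: sqrt_continuous.
exact: exprn_continuous.
Qed.

Lemma jacobi_sum_cvg (R : realType) (a : R) (b n : nat) (u v : R) :
  jacobi_sum a b n (q.1 / 4) (q.2 / 4) @[q --> (u, v)]
    --> jacobi_sum a b n (u / 4) (v / 4).
Proof.
rewrite /jacobi_sum; set N := jacobi_scale a n.
have hP j (f : R * R -> R) : f q @[q --> (u, v)] --> f (u, v) ->
    (jacobi_poly a b j).[f q / 4 / N] @[q --> (u, v)]
    --> (jacobi_poly a b j).[f (u, v) / 4 / N].
  move=> hf; apply: continuous_cvg; first exact: continuous_horner.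
  by do 2 (apply: cvgM; last exact: cvg_cst).
apply: (@cvg_big R _ +%R 0 xpredT).
- exact: add_continuous.
- move=> j _; apply: cvgM; first exact: cvg_cst.
  by apply: cvgM; [apply: (hP _ fst)|apply: (hP _ snd)];
    [exact: cvg_fst|exact: cvg_snd].
Qed.

(** The bounds by [n] keep nearby points of the quadrant in the range of [rescaled_jacobi_kernelE],
    whose right-hand side is continuous. *)
Lemma rescaled_jacobi_kernel_cvg (R : realType) (a : R) (b n : nat)
    (p : nat -> {poly R}) (u v : R) : 0 <= a -> (0 < n)%N ->
  orthonormal_jacobi a b%:R p ->
  0 <= u < n%:R -> 0 <= v < n%:R ->
  rescaled_jacobi_kernel a b%:R p n q.1 q.2
    @[q --> within (@off_diag_quadrant R) (nbhs (u, v))]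
  --> rescaled_jacobi_kernel a b%:R p n u v.
Proof.
move=> a0 n0 op /andP[u0 un] /andP[v0 vn].
have nN : n%:R <= jacobi_scale a n.
  have n1 : 1 <= n%:R :> R by rewrite ler1n.
  have h : n%:R * 1 <= n%:R * (n%:R + a) by rewrite ler_wpM2l// ler_wpDr.
  by rewrite /jacobi_scale; lra.
have hE (s t : R) : 0 <= s < n%:R -> 0 <= t < n%:R ->
    rescaled_jacobi_kernel a b%:R p n s t = 4^-1 * (edge_factor a b n (s / 4)
      * edge_factor a b n (t / 4) * jacobi_sum a b n (s / 4) (t / 4)).
  move=> /andP[s0 sn] /andP[t0 tn].
  rewrite -(rescaled_jacobi_kernelE a0 n0 op); try by apply/andP; split; lra.
  by rewrite ![4 * _]mulrC !divfK.
rewrite hE ?u0 ?v0//.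
apply: (@cvg_trans _ ((4^-1 * (edge_factor a b n (q.1 / 4)
      * edge_factor a b n (q.2 / 4) * jacobi_sum a b n (q.1 / 4) (q.2 / 4)))
    @[q --> within (@off_diag_quadrant R) (nbhs (u, v))])).
  apply: near_eq_cvg; rewrite near_withinE; near=> q => -[q1 q2 _].
  rewrite hE//.
    rewrite (ltW q1)/=; near: q.
    by apply: (@cvgr_lt _ _ _ _ fst u) => //; exact: cvg_fst.
  rewrite (ltW q2)/=; near: q.
  by apply: (@cvgr_lt _ _ _ _ snd v) => //; exact: cvg_snd.
apply: cvg_within_filter.
apply: cvgM; first exact: cvg_cst.
apply: cvgM; last exact: jacobi_sum_cvg.
apply: cvgM.
  apply: (@continuous_cvg _ _ _ _ _ (fun q : R * R => q.1 / 4) (edge_factor a b n)).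
    by apply: edge_factor_continuous => //; lra.
  by apply: cvgM; [exact: cvg_fst|exact: cvg_cst].
apply: (@continuous_cvg _ _ _ _ _ (fun q : R * R => q.2 / 4) (edge_factor a b n)).
  by apply: edge_factor_continuous => //; lra.
by apply: cvgM; [exact: cvg_snd|exact: cvg_cst].
Unshelve. all: by end_near. Qed.

(** This makes the filter in the definition of [bessel_kernel] proper. *)
Lemma closure_off_diag_quadrant (R : realType) (u v : R) :
  0 <= u -> 0 <= v -> closure (@off_diag_quadrant R) (u, v).
Proof.
move=> u0 v0 B /nbhs_ballP[e /= e0 hB].
have [uv|uv] := eqVneq (u + e / 2) (v + e / 2).
  (* Equal shifts would stay on the diagonal, so the second one is halved. *)
  exists (u + e / 2, v + e / 4); split.
    by split => /=; [lra|lra|rewrite uv; apply/negP => /eqP; lra].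
  by apply: hB; split; rewrite /ball/= opprD addrA subrr sub0r normrN ger0_norm; lra.
exists (u + e / 2, v + e / 2); split; first by split => //=; lra.
by apply: hB; split; rewrite /ball/= opprD addrA subrr sub0r normrN ger0_norm; lra.
Qed.

Lemma rescaled_kernel_uniform (R : realType) (b : nat) (a : nat -> R)
    (p : nat -> nat -> {poly R}) (M : R) :
  (forall n, 0 <= a n) ->
  (forall n, orthonormal_jacobi (a n) b%:R (p n)) -> 0 <= M ->
  exists (C : R) (n0 : nat), forall n u v, (n0 <= n)%N ->
    0 <= u <= M -> 0 <= v <= M ->
    `|rescaled_jacobi_kernel (a n) b%:R (p n) n u v - bessel_kernel b u v|
    <= C / n%:R.
Proof.
move=> ha hp M0.
(* The extra 1 leaves room for points that approach [(u, v)] with coordinates beyond [M]. *)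
have M1 : 0 <= M + 1 by rewrite addr_ge0.
have [C C0 HC] := @rescaled_kernel_off_diag R b (M + 1) M1.
pose n0 := (Num.truncn (2 * (M + 1))).+1.
have n0M n : (n0 <= n)%N -> (0 < n)%N /\ 2 * (M + 1) <= n%:R.
  move=> n0n; split; first exact: leq_trans n0n.
  by rewrite ltW// (lt_le_trans (truncnS_gt _))// ler_nat.
have off n u v : (n0 <= n)%N -> 0 < u <= M + 1 -> 0 < v <= M + 1 -> u != v ->
   `|rescaled_jacobi_kernel (a n) b%:R (p n) n u v - bessel_kernel_off_diag b u v|
    <= C / n%:R.
  move=> /n0M[npos nM] /andP[u0 uM] /andP[v0 vM] uv.
  have := HC (a n) n (p n) (u / 4) (v / 4) (ha n) npos nM (hp n).
  rewrite ![4 * _]mulrC !divfK//; apply.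
  - by apply/andP; split; lra.
  - by apply/andP; split; lra.
  - by apply: contra uv => /eqP h; apply/eqP; lra.
exists C, n0 => n u v n0n /andP[u0 uM] /andP[v0 vM].
rewrite /bessel_kernel; case: ifPn => [/and3P[u0' v0' uv]|_].
  by apply: off => //; apply/andP; split => //; lra.
have PF : ProperFilter (within (@off_diag_quadrant R) (nbhs (u, v))).
  exact/within_nbhs_proper/closure_off_diag_quadrant.
apply: (@uniform_approx_lim R _ _
  (fun n q => rescaled_jacobi_kernel (a n) b%:R (p n) n q.1 q.2)
  (fun n => rescaled_jacobi_kernel (a n) b%:R (p n) n u v) _ C n0) => //.
  move=> k /n0M[kpos kM].
  by apply: rescaled_jacobi_kernel_cvg => //; apply/andP; split => //; lra.
move=> k n0k; rewrite near_withinE; near=> q => -[q1 q2 q12].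
apply: off => //.
  rewrite q1/= ltW//; near: q.
  by apply: (@cvgr_lt _ _ _ _ fst u); [exact: cvg_fst|lra].
rewrite q2/= ltW//; near: q.
by apply: (@cvgr_lt _ _ _ _ snd v); [exact: cvg_snd|lra].
Unshelve. all: by end_near. Qed.

Theorem theorem4p18 (R : realType) (b : nat) (a : nat -> R)
    (p : nat -> nat -> {poly R})
    (ha : forall n, 0 <= a n)
    (hp : forall n, orthonormal_jacobi (a n) b%:R (p n))
    (hliminf : (0 <= limn_einf (fun n => (a n / n%:R)%:E) < +oo)%E) :
  (forall u v : R, 0 <= u -> 0 <= v ->
     (fun n : nat =>
        rescaled_jacobi_kernel (a n) b%:R (p n) n u v - bessel_kernel b u v)
     =O_\oo (fun n : nat => n%:R^-1 : R)) /\
  (forall A : set R, compact A -> A `<=` [set x | 0 <= x] ->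
     exists C : R, \forall n \near \oo, forall u v : R, A u -> A v ->
       `| rescaled_jacobi_kernel (a n) b%:R (p n) n u v - bessel_kernel b u v |
       <= C / n%:R).
Proof.
split => [u v u0 v0|A cA A0].
  have M0 : 0 <= Num.max u v by rewrite le_max u0.
  have [C [n0 H]] := rescaled_kernel_uniform ha hp M0.
  (* A positive constant is required, and [C] carries no sign information. *)
  apply/eqO_exP; exists (`|C| + 1); first by rewrite ltr_wpDl.
  exists n0 => // n /= n0n.
  rewrite (le_trans (H n u v n0n _ _)) ?u0 ?v0 ?le_max ?lexx ?orbT//.
  rewrite [`|n%:R^-1|]ger0_norm ?invr_ge0// ler_wpM2r ?invr_ge0//.
  by rewrite (le_trans (ler_norm C))// lerDl.
have [M [_ hM]] := compact_bounded cA.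
(* Boundedness supplies a bound by every number strictly above [M]; this one is also nonnegative. *)
have M0 : 0 <= `|M| + 1 by rewrite addr_ge0.
have [C [n0 H]] := rescaled_kernel_uniform ha hp M0.
have AM u : A u -> 0 <= u <= `|M| + 1.
  move=> Au; rewrite (A0 _ Au)/= (le_trans (ler_norm u))//.
  by apply: hM Au; rewrite (le_lt_trans (ler_norm M))// ltrDl.
exists C; exists n0 => // n /= n0n u v Au Av.
by apply: H => //; exact: AM.
Qed.
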